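(* Let $\mu>0$ be an upper bound on the scaling exponent (as defined in the context). There exists a constant $c>0$, independent of $N$, $P$, $p_e$, $\epsilon$ and $W$, such that the following holds. Let $W$ be a binary memoryless symmetric (BMS) channel with symmetric capacity $I(W)$, fix $p_e\in(0,1)$, and consider the sequence of polar codes $\mathcal{C}_{\rm polar}(p_e,W,N)$ of increasing block lengths $N=2^n$, whose rates approach $I(W)$. Then for every $\epsilon>0$ there exists $\bar N(\epsilon)$ such that, for every $N=2^n\ge \bar N(\epsilon)$ and every integer $P$ with $1\le P\le N/2$, the latency of the simplified successive-cancellation (SSC) decoder of $\mathcal{C}_{\rm polar}(p_e,W,N)$ with $P$ processing elements is at most $$c\,N^{1-1/\mu}+(2+\epsilon)\,\frac{N}{P}\,\log_2\log_2\frac{N}{P}.$$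
   Context: **Channels.** A BMS channel $W:\mathcal X\to\mathcal Y$ has input alphabet $\mathcal X=\{0,1\}$, an arbitrary output alphabet $\mathcal Y$, and transition probabilities $W(y\mid x)$, and is symmetric: there is an involution $\pi$ of $\mathcal Y$ with $W(y\mid 1)=W(\pi(y)\mid 0)$. Its Bhattacharyya parameter is $Z(W)=\sum_{y\in\mathcal Y}\sqrt{W(y\mid 0)W(y\mid 1)}$. The symmetric capacity $I(W)$ is the mutual information between input and output for uniform input. **Polarization.** From $W$ define the channels $W^0:\mathcal X\to\mathcal Y^2$ and $W^1:\mathcal X\to\mathcal X\times\mathcal Y^2$ by $$W^0(y_1,y_2\mid x_1)=\sum_{x_2\in\mathcal X}\tfrac12 W(y_1\mid x_1\oplus x_2)W(y_2\mid x_2),\qquad W^1(y_1,y_2,x_1\mid x_2)=\tfrac12 W(y_1\mid x_1\oplus x_2)W(y_2\mid x_2).$$ For $n\ge 1$ and $1\le i\le 2^n$, let $W_n^{(i)}=(((W^{b_1^{(i)}})^{b_2^{(i)}})^{\cdots})^{b_n^{(i)}}$, where $(b_1^{(i)},\dots,b_n^{(i)})$ is the $n$-bit binary representation of $i-1$ (with $b_1^{(i)}$ the most significant bit). **Polar code.** For $N=2^n$ and $p_e\in(0,1)$, the polar code $\mathcal C_{\rm polar}(p_e,W,N)$ is defined by declaring position $i\in\{1,\dots,N\}$ an information position if $Z(W_n^{(i)})<p_e/N$, and a frozen position otherwise. Its rate is the fraction of information positions. **Upper bound on the scaling exponent.** $\mu$ is an upper bound on the scaling exponent if there exists a function $h:[0,1]\to[0,1]$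 with $h(0)=h(1)=0$, $h(x)>0$ for all $x\in(0,1)$, and $$\sup_{\substack{x\in(0,1)\\ y\in[x\sqrt{2-x^2},\,2x-x^2]}}\frac{h(x^2)+h(y)}{2h(x)}<2^{-1/\mu}.$$ **SSC decoding and latency.** Consider the complete binary tree of depth $n$, with root at level $n$ and $N=2^n$ leaves at level $0$; the leaves, from left to right, correspond to positions $i=1,\dots,N$ (so the leaf for position $i$ is reached from the root by following $b_1^{(i)},\dots,b_n^{(i)}$, with $0$ = left and $1$ = right). A node is a Rate-0 node if all leaves of the subtree rooted at it are frozen positions, and a Rate-1 node if all these leaves are information positions. The SSC decoding tree is obtained by removing all proper descendants of every Rate-0 node and of every Rate-1 node. With $P$ processing elements, an edge connecting a node at level $s+1$ to a node at level $s$ has decoding weight $\lceil 2^s/P\rceil$. The latency of the SSC decoder with $P$ processing elements is the sum of the decoding weights of all edges of the SSC decoding tree. *)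

(* Defs.v *)
From HB Require Import structures.
From mathcomp Require Import all_boot all_order all_algebra.
From mathcomp Require Import all_classical all_reals all_analysis.

Set Implicit Arguments.
Unset Strict Implicit.
Unset Printing Implicit Defensive.

Import Order.TTheory GRing.Theory Num.Theory.
Import numFieldNormedType.Exports.

Local Open Scope classical_set_scope.
Local Open Scope ring_scope.

Definition log2 (R : realType) (x : R) : R := ln x / ln 2.

(** The input alphabet {0,1} is [bool] (0 = [false], 1 = [true]). The output
    alphabet is arbitrary; sums over it are the unconditional sums [\esum] of
    nonnegative terms, with values in [\bar R]. *)
Record channel (R : realType) := Channel {
  output : choiceType;
  trans : bool -> output -> R   (* trans x y = W(y | x) *)
}.

Section Channels.
Variable R : realType.
Implicit Type W : channel R.

Definition is_BMS W : Prop :=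
  [/\ forall x (y : output W), 0 <= trans x y,
      forall x : bool, (\esum_(y in [set: output W]) (trans x y)%:E = 1)%E &
      exists pi : output W -> output W,
        involutive pi /\ forall y, trans true y = trans false (pi y)].

Definition bhattacharyya W : \bar R :=
  \esum_(y in [set: output W])
    (Num.sqrt (trans false y * trans true y))%:E.

(** Mutual information (in bits) between a uniform input and the output:
    I(W) = sum_y sum_x (1/2) W(y|x) log2 (W(y|x) / q(y)), with q the output
    distribution. The inner sum over x is nonnegative for every y (log-sum
    inequality), so that [\esum] applies; [ln 0 = 0] and [0^-1 = 0] give the
    convention 0 log 0 = 0. *)
Definition output_prob W (y : output W) : R := \sum_(x : bool) trans x y / 2.

Definition symmetric_capacity W : \bar R :=
  \esum_(y in [set: output W])
    (\sum_(x : bool) trans x y / 2 * log2 (trans x y / output_prob y))%:E.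

Definition polar0 W : channel R :=
  @Channel R (output W * output W)%type
    (fun x1 y => \sum_(x2 : bool) 2^-1 * trans (x1 (+) x2) y.1 * trans x2 y.2).

(** The output (y1, y2, x1) is encoded as [((y1, y2), x1)]. *)
Definition polar1 W : channel R :=
  @Channel R (output W * output W * bool)%type
    (fun x2 y => 2^-1 * trans (y.2 (+) x2) y.1.1 * trans x2 y.1.2).

Definition polar W (b : bool) : channel R := if b then polar1 W else polar0 W.

End Channels.

(** The [n]-bit binary representation of [i], most significant bit first.
    Positions are numbered from 0: the 1-based position i is [i - 1 : 'I_(2 ^ n)]. *)
Definition bits (n i : nat) : seq bool :=
  [seq odd (i %/ 2 ^ (n - j.+1)) | j <- iota 0 n].

Section PolarCodes.
Variable R : realType.
Implicit Types (W : channel R) (pe : R).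

Definition bit_channel W (n : nat) (i : 'I_(2 ^ n)) : channel R :=
  foldl (@polar R) W (bits n i).

Definition polar_info pe W (n : nat) : {set 'I_(2 ^ n)} :=
  [set i | (bhattacharyya (bit_channel W i) < (pe / (2 ^ n)%:R)%:E)%E]%SET.

Definition polar_rate pe W (n : nat) : R :=
  #|polar_info pe W n|%:R / (2 ^ n)%:R.

End PolarCodes.

(** In the complete binary tree of depth [n], a node at level [s] is the string
    of [n - s] bits that leads to it from the root; the leaf of position [i] is
    [bits n i]. A code is given by its set [A] of information positions. *)
Section SSC.
Variables (n : nat) (A : {set 'I_(2 ^ n)}).

Definition leaf_below (v : seq bool) (i : 'I_(2 ^ n)) : bool :=
  prefix v (bits n i).

Definition rate0 (v : seq bool) : bool :=
  [forall i, leaf_below v i ==> (i \notin A)].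

Definition rate1 (v : seq bool) : bool :=
  [forall i, leaf_below v i ==> (i \in A)].

(** [take k v] with [k < size v] ranges over the proper ancestors of [v]. *)
Definition in_ssc_tree (v : seq bool) : bool :=
  [forall k : 'I_(size v), ~~ rate0 (take k v) && ~~ rate1 (take k v)].

(** Every edge is indexed by its lower endpoint [v], at level [s < n]; the upper
    endpoint is in the SSC tree as soon as [v] is. *)
Definition ssc_latency (P : nat) : int :=
  \sum_(s < n) \sum_(v : (n - s).-tuple bool | in_ssc_tree v)
    Num.ceil ((2 ^ s)%:R / P%:R : rat).

End SSC.

Definition scaling_ratios (R : realType) (h : R -> R) : set R :=
  [set (h (p.1 ^+ 2) + h p.2) / (2 * h p.1)
  | p in [set p : R * R |
      0 < p.1 < 1 /\
      p.1 * Num.sqrt (2 - p.1 ^+ 2) <= p.2 <= 2 * p.1 - p.1 ^+ 2]].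

(** The supremum is taken in the extended reals, so that an unbounded set of
    ratios is excluded. *)
Definition scaling_exponent_upper_bound (R : realType) (mu : R) : Prop :=
  exists h : R -> R,
    [/\ forall x : R, 0 <= x <= 1 -> 0 <= h x <= 1,
        h 0 = 0 /\ h 1 = 0,
        forall x : R, 0 < x < 1 -> 0 < h x &
        (ereal_sup [set r%:E | r in scaling_ratios h]
         < (2 `^ (- mu^-1))%:E)%E].

(* Main.v *)
(** Write [z v] for the Bhattacharyya parameter of the channel at the node [v].
    Then [z (v1) = z v ^ 2] and [z v * sqrt (2 - z v ^ 2) <= z (v0) <=
    2 * z v - z v ^ 2], so that both [z] and [1 - z ^ 2] are squared by one of the
    two bits and at most doubled by the other.  A node at depth [d < n] that is
    neither Rate-0 nor Rate-1 ("mixed") has [z] and [1 - z ^ 2] at least [8 ^ - n]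
    once [n] is large.  As [ceil t <= t + 1], the latency is at most
    [2 * \sum_d 2 ^ d * p d + N / P * \sum_d p d], where [p d] is the proportion
    of mixed nodes at depth [d].

    The first sum is [o (N ^ (1 - 1 / mu))]: the function [h] can be perturbed
    into a potential that still contracts by a factor less than [2 ^ (- 1 / mu)]
    and dominates a multiple of [(z * (1 - z ^ 2)) ^ alpha] with [alpha] as small as
    we like.

    The second sum is at most [(2 + eps) * log2 n + O(1)]: after a small
    fraction of [d] steps one of [z], [1 - z ^ 2] is exponentially small in [d]
    outside an event of exponentially small probability, and from there on about
    [d / 2] squarings bring it below [2 ^ (- 2 ^ (d / 2))].  Finally either
    [N / P * n <= N ^ (1 - 1 / mu)], and the second term is absorbed by the first,
    or [N / P] is at least a fixed power of [N], whence
    [log2 n <= log2 (log2 (N / P)) + O(1)]. *)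

Require Import Defs.
From mathcomp Require Import all_boot all_order all_algebra.
From mathcomp Require Import all_classical all_reals all_analysis.
From mathcomp Require Import ring lra zify.
Import Order.TTheory GRing.Theory Num.Theory.
Import numFieldNormedType.Exports.
Local Open Scope classical_set_scope.
Local Open Scope ring_scope.

Set Implicit Arguments.
Unset Strict Implicit.
Unset Printing Implicit Defensive.

(** * Unconditional sums of nonnegative reals *)

Section HasEsum.
Variable R : realType.

(** A relation rather than a value: nonnegativity and finiteness travel together, so that sums can
    be handled as reals. *)
Definition has_esum (T : choiceType) (f : T -> R) (s : R) : Prop :=
  (forall y, 0 <= f y) /\ (\esum_(y in [set: T]) (f y)%:E = s%:E)%E.

Lemma has_esum_ge0 (T : choiceType) (f : T -> R) s : has_esum f s -> 0 <= s.
Proof.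
by move=> [f0 fs]; rewrite -lee_fin -fs; apply: esum_ge0 => y _; rewrite lee_fin.
Qed.

Lemma has_esumD (T : choiceType) (f g : T -> R) s t :
  has_esum f s -> has_esum g t -> has_esum (fun y => f y + g y) (s + t).
Proof.
move=> [f0 fs] [g0 gt]; split=> [y|]; first exact: addr_ge0.
under eq_esum do rewrite EFinD.
by rewrite esumD ?fs ?gt // => y _; rewrite lee_fin.
Qed.

Lemma le_has_esum (T : choiceType) (f g : T -> R) s t :
  has_esum f s -> has_esum g t -> (forall y, f y <= g y) -> s <= t.
Proof.
move=> [_ fs] [_ gt] fg; rewrite -lee_fin -fs -gt.
by apply: le_esum => y _; rewrite lee_fin.
Qed.

Lemma eq_has_esum (T : choiceType) (f g : T -> R) s :
  (forall y, f y = g y) -> has_esum f s -> has_esum g s.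
Proof.
move=> fg [f0 fs]; split=> [y|]; first by rewrite -fg.
by rewrite -fs; apply: eq_esum => y _; rewrite fg.
Qed.

Lemma has_esum_dom (T : choiceType) (f g : T -> R) s :
  has_esum f s -> (forall y, 0 <= g y <= f y) -> 
  has_esum g (fine (\esum_(y in [set: T]) (g y)%:E)).
Proof.
move=> [f0 fs] gf.
have g0 y : 0 <= g y by have /andP[] := gf y.
have le_gs : (\esum_(y in [set: T]) (g y)%:E <= s%:E)%E.
  by rewrite -fs; apply: le_esum => y _; rewrite lee_fin; have /andP[] := gf y.
have ge0_g : (0 <= \esum_(y in [set: T]) (g y)%:E)%E.
  by apply: esum_ge0 => y _; rewrite lee_fin.
split=> //.
rewrite fineK // ge0_fin_numE //.
exact: le_lt_trans le_gs (ltry _).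
Qed.

(** One inequality suffices: used with [c] and then with [c^-1], it gives the equality in
    [has_esumZ]. *)
Lemma esumZ_le (T : choiceType) (f : T -> R) (c : R) :
  0 <= c -> (forall y, 0 <= f y) ->
  (\esum_(y in [set: T]) (c * f y)%:E
   <= c%:E * \esum_(y in [set: T]) (f y)%:E)%E.
Proof.
move=> c0 f0; apply: ge_ereal_sup => _ [X [finX _]] <-.
under eq_fsbigr do rewrite EFinM.
rewrite -ge0_mule_fsumr; last by move=> y; rewrite lee_fin.
apply: lee_wpmul2l; first by rewrite lee_fin.
by apply: ereal_sup_ubound; exists X.
Qed.

Lemma has_esumZ (T : choiceType) (f : T -> R) (c s : R) :
  0 <= c -> has_esum f s -> has_esum (fun y => c * f y) (c * s).
Proof.
move=> c0 [f0 fs]; split=> [y|]; first exact: mulr_ge0.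
have [->|cN0] := eqVneq c 0.
  by rewrite mul0r; apply: esum1 => y _; rewrite mul0r.
apply/eqP; rewrite eq_le; apply/andP; split.
  by have := esumZ_le c0 f0; rewrite fs -EFinM.
have cf0 y : 0 <= c * f y by exact: mulr_ge0.
have cV0 : 0 <= c^-1 by rewrite invr_ge0.
have := esumZ_le cV0 cf0.
under eq_esum do rewrite mulKf //.
have cp : 0 < c by rewrite lt_neqAle eq_sym cN0.
rewrite fs => /(lee_wpmul2l (_ : (0 <= c%:E)%E)); rewrite lee_fin => /(_ c0).
by rewrite muleA -!EFinM divff // mul1e.
Qed.

Lemma has_esum_fubini (T1 T2 : choiceType) (F : T1 * T2 -> R) (G : T1 -> R) s :
  (forall y, has_esum (fun x => F (y, x)) (G y)) ->
  has_esum F s <-> has_esum G s.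
Proof.
move=> FG.
have F0 p : 0 <= F p by case: p => y x; have [] := FG y.
have G0 y : 0 <= G y by exact: has_esum_ge0 (FG y).
suff FGE : \esum_(p in [set: T1 * T2]) (F p)%:E
         = \esum_(y in [set: T1]) (G y)%:E.
  by split=> -[_ hs]; split=> //; rewrite -hs FGE.
under [RHS]eq_esum do rewrite -(proj2 (FG _)).
rewrite (esum_esum (a := fun y x => (F (y, x))%:E)); last first.
  by move=> y x _ _; rewrite lee_fin.
rewrite (_ : [set: T1] `*`` (fun=> [set: T2]) = setT).
  by apply: eq_esum => -[].
by apply/seteqP; split=> [p _ //|p _]; split.
Qed.

Lemma has_esum_prod (T1 T2 : choiceType) (f : T1 -> R) (g : T2 -> R) s t :
  has_esum f s -> has_esum g t ->
  has_esum (fun p : T1 * T2 => f p.1 * g p.2) (s * t).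
Proof.
move=> fs gt; apply/(@has_esum_fubini _ _ _ (fun y => t * f y)) => /= [y|].
  by rewrite mulrC; apply: has_esumZ => //; have [] := fs.
by rewrite mulrC; apply: has_esumZ => //; apply: has_esum_ge0 gt.
Qed.

Lemma has_esum_bool (f : bool -> R) :
  (forall b, 0 <= f b) -> has_esum f (f true + f false).
Proof.
move=> f0; split=> //.
rewrite (esumID [set true]) => [|b _]; last by rewrite lee_fin.
rewrite (_ : setT `&` [set true] = [set true]); last by rewrite setTI.
rewrite (_ : setT `&` ~` [set true] = [set false]); last first.
  by rewrite setTI; apply/seteqP; split=> [[/(_ erefl)|]|[]] //=.
by rewrite !esum_set1 ?lee_fin.
Qed.

(* Minkowski: [(U, V)] is the sum of the planar vectors [(u y, v y)]. *)
Lemma has_esum_sqrt (T : choiceType) (u v : T -> R) U V s :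
  has_esum u U -> has_esum v V ->
  has_esum (fun y => Num.sqrt (u y ^+ 2 + v y ^+ 2)) s ->
  Num.sqrt (U ^+ 2 + V ^+ 2) <= s.
Proof.
move=> uU vV sE; set S := Num.sqrt _.
have U0 := has_esum_ge0 uU; have V0 := has_esum_ge0 vV.
have SS : S ^+ 2 = U ^+ 2 + V ^+ 2 by rewrite sqr_sqrtr // addr_ge0 ?sqr_ge0.
have [S0|S_neq0] := eqVneq S 0; first by rewrite S0 (has_esum_ge0 sE).
have Sp : 0 < S by rewrite lt_neqAle eq_sym S_neq0 sqrtr_ge0.
(* Project every vector on the unit vector [(U / S, V / S)]: the projections add up to [S], and by
   Cauchy-Schwarz each is at most the length of its vector. *)
have -> : S = U / S * U + V / S * V.
  by rewrite -[LHS](mulfK S_neq0) -expr2 SS; field.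
have hu := has_esumZ (divr_ge0 U0 (ltW Sp)) uU.
have hv := has_esumZ (divr_ge0 V0 (ltW Sp)) vV.
apply: le_has_esum (has_esumD hu hv) sE _ => y.
have u0 : 0 <= u y by have [] := uU.
have v0 : 0 <= v y by have [] := vV.
have -> : U / S * u y + V / S * v y = (U * u y + V * v y) / S by field.
rewrite ler_pdivrMr // -[S]/(Num.sqrt _) -sqrtrM ?addr_ge0 ?sqr_ge0 //.
rewrite -[leLHS]ger0_norm ?addr_ge0 ?mulr_ge0 // -sqrtr_sqr.
rewrite ler_wsqrtr //.
have := sqr_ge0 (U * v y - V * u y); nra.
Qed.

End HasEsum.

(** * Bhattacharyya parameters of polarized channels *)

Section ChannelBounds.
Variable R : realType.
Implicit Types W : channel R.

Lemma has_esum_unique (T : choiceType) (f : T -> R) s t :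
  has_esum f s -> has_esum f t -> s = t.
Proof. by move=> [_ fs] [_]; rewrite fs => -[]. Qed.

Definition is_channel W := forall x, has_esum (@trans R W x) 1.

Lemma is_BMS_channel W : is_BMS W -> is_channel W.
Proof. by move=> [W0 W1 _] x; split. Qed.

Definition zpar W : R := fine (bhattacharyya W).

(** For a channel, [(hdist y, gmean y)] is a planar vector of length [amean y], which brings the
    bounds for [polar0] down to planar geometry. *)
Definition gmean W (y : output W) : R := Num.sqrt (trans false y * trans true y).
Definition amean W (y : output W) : R := (trans false y + trans true y) / 2.
Definition hdist W (y : output W) : R := `|trans false y - trans true y| / 2.

Lemma has_esum_amean W : is_channel W -> has_esum (@amean W) 1.
Proof.
move=> hW; have half0 : 0 <= 2^-1 :> R by rewrite invr_ge0.
have := has_esumZ half0 (has_esumD (hW false) (hW true)).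
rewrite mulVf //; apply: eq_has_esum => y.
by rewrite /amean mulrC.
Qed.

Lemma trans_ge0 W x y : is_channel W -> 0 <= @trans R W x y.
Proof. by move=> hW; have [] := hW x. Qed.

Lemma gmean_sqr W y : is_channel W ->
  @gmean W y ^+ 2 = trans false y * trans true y.
Proof. by move=> hW; rewrite sqr_sqrtr // mulr_ge0 ?trans_ge0. Qed.

Lemma hdist_sqr W y : is_channel W ->
  @hdist W y ^+ 2 = amean y ^+ 2 - gmean y ^+ 2.
Proof.
move=> hW; rewrite gmean_sqr // /hdist /amean expr_div_n real_normK ?num_real //.
by field.
Qed.

Lemma amean_ge0 W y : is_channel W -> 0 <= @amean W y.
Proof. by move=> hW; rewrite divr_ge0 ?addr_ge0 ?trans_ge0. Qed.

Lemma gmean_le_amean W y : is_channel W -> 0 <= gmean y <= @amean W y.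
Proof.
move=> hW; rewrite sqrtr_ge0 /=.
rewrite -(@ler_pXn2r _ 2) ?nnegrE ?sqrtr_ge0 ?amean_ge0 //.
by rewrite -subr_ge0 -hdist_sqr // sqr_ge0.
Qed.

Lemma has_esum_zpar W : is_channel W -> has_esum (@gmean W) (zpar W).
Proof.
move=> hW; apply: has_esum_dom (has_esum_amean hW) _ => y.
exact: gmean_le_amean.
Qed.

Lemma bhattacharyyaE W : is_channel W -> bhattacharyya W = (zpar W)%:E.
Proof. by move=> hW; rewrite -(proj2 (has_esum_zpar hW)). Qed.

Lemma zpar_itv W : is_channel W -> 0 <= zpar W <= 1.
Proof.
move=> hW; rewrite (has_esum_ge0 (has_esum_zpar hW)) /=.
apply: le_has_esum (has_esum_zpar hW) (has_esum_amean hW) _ => y.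
by have /andP[] := gmean_le_amean y hW.
Qed.

Lemma is_channel_polar1 W : is_channel W -> is_channel (polar1 W).
Proof.
move=> hW x; have half0 : 0 <= 2^-1 :> R by rewrite invr_ge0.
apply/(has_esum_fubini (G := fun p => 2^-1 * (trans (true (+) x) p.1 * trans x p.2)
  + 2^-1 * (trans (false (+) x) p.1 * trans x p.2))) => [p|] /=.
  rewrite !mulrA.
  apply: (has_esum_bool (f := fun b => 2^-1 * trans (b (+) x) p.1 * trans x p.2)).
  by move=> b; rewrite !mulr_ge0 ?trans_ge0.
have hp (c : bool) := has_esumZ half0 (has_esum_prod (hW c) (hW x)).
have := has_esumD (hp (true (+) x)) (hp (false (+) x)).
by rewrite !mulr1 (_ : 2^-1 + 2^-1 = 1) //; field.
Qed.

Lemma is_channel_polar0 W : is_channel W -> is_channel (polar0 W).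
Proof.
move=> hW x; have half0 : 0 <= 2^-1 :> R by rewrite invr_ge0.
have hp (c : bool) := has_esumZ half0 (has_esum_prod (hW (x (+) c)) (hW c)).
have := has_esumD (hp true) (hp false).
rewrite !mulr1 (_ : 2^-1 + 2^-1 = 1); last by field.
by apply: eq_has_esum => p; rewrite /= big_bool /= !mulrA.
Qed.

Lemma is_channel_polar W b : is_channel W -> is_channel (polar W b).
Proof. by case: b => /=; [exact: is_channel_polar1|exact: is_channel_polar0]. Qed.

Lemma zpar_polar1 W : is_channel W -> zpar (polar1 W) = zpar W ^+ 2.
Proof.
move=> hW; apply: has_esum_unique (has_esum_zpar (is_channel_polar1 hW)) _.
have half0 : 0 <= 2^-1 :> R by rewrite invr_ge0.
have hE (p : output W * output W) (b : bool) :
    @gmean (polar1 W) (p, b) = 2^-1 * (gmean p.1 * gmean p.2).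
  rewrite /gmean /= -sqrtrM ?mulr_ge0 ?trans_ge0 //.
  rewrite -[X in X * Num.sqrt _](ger0_norm half0) -sqrtr_sqr -sqrtrM ?sqr_ge0 //.
  by congr Num.sqrt; case: b => /=; ring.
apply/(has_esum_fubini (G := fun p => gmean p.1 * gmean p.2)) => [p|].
  rewrite [X in has_esum _ X](_ : _ = @gmean (polar1 W) (p, true)
     + @gmean (polar1 W) (p, false)); last by rewrite !hE; field.
  by apply: has_esum_bool => b; rewrite sqrtr_ge0.
by rewrite expr2; apply: has_esum_prod; exact: has_esum_zpar.
Qed.

Lemma gmean_polar0 W (p : output W * output W) : is_channel W ->
  @gmean (polar0 W) p
  = Num.sqrt ((hdist p.1 * gmean p.2) ^+ 2 + (gmean p.1 * amean p.2) ^+ 2).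
Proof.
move=> hW; congr Num.sqrt.
rewrite (exprMn 2 (hdist _)) (exprMn 2 (gmean _)) hdist_sqr // !gmean_sqr //.
by rewrite /= !big_bool /amean /=; field.
Qed.

(** Obtained by summing the pointwise inequality [H]; as [amean] sums to 1, each product on its
    right sums to [zpar W]. *)
Lemma zpar_polar0_le W : is_channel W ->
  zpar (polar0 W) <= 2 * zpar W - zpar W ^+ 2.
Proof.
move=> hW; have hz := has_esum_zpar hW; have hq := has_esum_amean hW.
have h0 := has_esum_zpar (is_channel_polar0 hW).
have := le_has_esum (has_esumD h0 (has_esum_prod hz hz))
  (has_esumD (has_esum_prod hz hq) (has_esum_prod hq hz)).
suff H p : @gmean (polar0 W) p + gmean p.1 * gmean p.2 <=
    gmean p.1 * amean p.2 + amean p.1 * gmean p.2 by move/(_ H); lra.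
have /andP[g1 gq1] := gmean_le_amean p.1 hW.
have /andP[g2 gq2] := gmean_le_amean p.2 hW.
have q1 := amean_ge0 p.1 hW; have q2 := amean_ge0 p.2 hW.
rewrite -lerBrDr gmean_polar0 //.
set r := leRHS; have r0 : 0 <= r by rewrite /r; nra.
rewrite -[r]ger0_norm // -sqrtr_sqr; apply: ler_wsqrtr.
rewrite (exprMn 2 (hdist _)) hdist_sqr // /r -subr_ge0.
rewrite (_ : _ - _ = 2 * (gmean p.1 * gmean p.2
    * ((amean p.1 - gmean p.1) * (amean p.2 - gmean p.2)))); last by ring.
by rewrite !mulr_ge0 ?subr_ge0.
Qed.

(** Minkowski is used twice. Over the second output it bounds the inner sum [G y] below by the
    length of [(hdist y * Z, gmean y)], which is also that of [(Z * amean y, sqrt (1 - Z ^ 2) *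
    gmean y)]. Over the first output it then gives [sqrt (Z ^ 2 + (1 - Z ^ 2) * Z ^ 2)]. *)
Lemma zpar_polar0_ge W : is_channel W ->
  zpar W * Num.sqrt (2 - zpar W ^+ 2) <= zpar (polar0 W).
Proof.
move=> hW; have hz := has_esum_zpar hW; have hq := has_esum_amean hW.
have h0 := has_esum_zpar (is_channel_polar0 hW).
have /andP[z0 z1] := zpar_itv hW; set Z := zpar W in hz z0 z1 *.
pose G y1 := fine (\esum_(y2 in [set: output W])
   (@gmean (polar0 W) (y1, y2))%:E).
have hd (y : output W) : 0 <= hdist y by rewrite divr_ge0.
have hg (y : output W) : 0 <= gmean y by rewrite sqrtr_ge0.
have hu y1 := has_esumZ (hd y1) hz.
have hv y1 := has_esumZ (hg y1) hq.
have hG y1 : has_esum (fun y2 => @gmean (polar0 W) (y1, y2)) (G y1).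
  apply: has_esum_dom (has_esumD (hu y1) (hv y1)) _ => y2.
  rewrite gmean_polar0 // sqrtr_ge0 /=.
  have u0 : 0 <= hdist y1 * gmean y2 by rewrite mulr_ge0.
  have v0 : 0 <= gmean y1 * amean y2 by rewrite mulr_ge0 ?amean_ge0.
  rewrite -[leRHS]ger0_norm ?addr_ge0 // -sqrtr_sqr; apply: ler_wsqrtr.
  by nra.
have {}h0 : has_esum G (zpar (polar0 W)) by apply/(has_esum_fubini _ hG).
have Z2 : 0 <= 1 - Z ^+ 2 by nra.
pose u (y : output W) := Z * amean y.
pose v (y : output W) := Num.sqrt (1 - Z ^+ 2) * gmean y.
have GE y : Num.sqrt (u y ^+ 2 + v y ^+ 2) <= G y.
  have -> : u y ^+ 2 + v y ^+ 2 = (hdist y * Z) ^+ 2 + (gmean y * 1) ^+ 2.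
    rewrite /u /v (exprMn 2 (hdist y)) (exprMn 2 (Num.sqrt _)) sqr_sqrtr //.
    by rewrite hdist_sqr //; ring.
  apply: has_esum_sqrt (hu y) (hv y) _.
  by apply: eq_has_esum (hG y) => y2; rewrite gmean_polar0.
have huv := has_esum_dom h0
  (fun y => introT andP (conj (sqrtr_ge0 (u y ^+ 2 + v y ^+ 2)) (GE y))).
apply: le_trans (le_has_esum huv h0 GE).
apply: le_trans (has_esum_sqrt (has_esumZ z0 hq)
  (has_esumZ (sqrtr_ge0 (1 - Z ^+ 2)) hz) huv).
rewrite mulr1 exprMn sqr_sqrtr // -[X in X * _]ger0_norm // -sqrtr_sqr.
rewrite -sqrtrM ?sqr_ge0 // ler_wsqrtr //.
by rewrite le_eqVlt; apply/orP; left; apply/eqP; ring.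
Qed.

End ChannelBounds.

(** * A contracting potential *)

Section Potential.
Variable R : realType.
Implicit Types (x y : R) (h : R -> R).

Definition polar_itv x : set R :=
  [set y | x * Num.sqrt (2 - x ^+ 2) <= y <= 2 * x - x ^+ 2].

Lemma sqrt_polar_itv x : 0 <= x <= 1 ->
  (x * Num.sqrt (2 - x ^+ 2)) ^+ 2 = 1 - (1 - x ^+ 2) ^+ 2.
Proof.
move=> /andP[x0 x1]; rewrite exprMn sqr_sqrtr; first by ring.
nra.
Qed.

Lemma polar_itv_bounds x y : 0 <= x <= 1 -> polar_itv x y ->
  [/\ 0 <= y <= 1, y <= 2 * x & 1 - y ^+ 2 <= (1 - x ^+ 2) ^+ 2].
Proof.
move=> x01 /andP[yl yu]; have xE := sqrt_polar_itv x01.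
have /andP[x0 x1] := x01.
have s0 : 0 <= x * Num.sqrt (2 - x ^+ 2) by rewrite mulr_ge0 ?sqrtr_ge0.
by split; nra.
Qed.

Lemma polar_itv_lt x : 0 < x < 1 ->
  x * Num.sqrt (2 - x ^+ 2) < 2 * x - x ^+ 2.
Proof.
move=> /andP[x0 x1]; have x01 : 0 <= x <= 1 by rewrite !ltW.
rewrite -(@ltr_pXn2r _ 2) ?nnegrE ?mulr_ge0 ?sqrtr_ge0 ?(ltW x0) //; last nra.
rewrite sqrt_polar_itv //.
have : 0 < x ^+ 2 * (1 - x) ^+ 2 by rewrite mulr_gt0 ?exprn_gt0 ?subr_gt0.
nra.
Qed.

(** If [r < 1], taking square roots [k] times from 1/2 gives [h (1/2) <= r ^ k * h x <= r ^ k],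
    which tends to 0 and contradicts [h (1/2) > 0]. *)
Lemma ge1_contraction h r :
  (forall x, 0 < x < 1 -> 0 < h x <= 1) ->
  (forall x y, 0 < x < 1 -> polar_itv x y -> h (x ^+ 2) + h y <= r * h x) ->
  1 <= r.
Proof.
move=> h01 hr; rewrite leNgt; apply/negP => r1.
have hsq x : 0 < x < 1 -> h (x ^+ 2) <= r * h x.
  move=> x01; have /andP[x0 x1] := x01; have lt := polar_itv_lt x01.
  have := hr x (2 * x - x ^+ 2) x01; rewrite /polar_itv /= lexx (ltW lt) => /(_ isT).
  have /h01/andP[+ _] : 0 < 2 * x - x ^+ 2 < 1 by apply/andP; split; nra.
  lra.
pose c : R := 2^-1.
have c01 : 0 < c < 1 by rewrite /c; lra.
have r0 : 0 <= r.
  have /hsq := c01; have /h01/andP[hc _] := c01.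
  have /h01/andP[hc2 _] : 0 < c ^+ 2 < 1 by rewrite /c; lra.
  move=> le; rewrite leNgt; apply/negP => r0; nra.
have Hk k : exists x, 0 < x < 1 /\ h c <= r ^+ k * h x.
  elim: k => [|k [x [x01 IH]]]; first by exists c; rewrite expr0 mul1r.
  have /andP[x0 x1] := x01.
  have sx : Num.sqrt x ^+ 2 = x by rewrite sqr_sqrtr // ltW.
  have s0 : 0 < Num.sqrt x by rewrite sqrtr_gt0.
  exists (Num.sqrt x).
  have s01 : 0 < Num.sqrt x < 1 by nra.
  split=> //; apply: le_trans IH _; rewrite exprSr -mulrA.
  by rewrite ler_wpM2l ?exprn_ge0 // -{1}sx hsq.
have hc0 : 0 < h c by have /h01/andP[] := c01.
have : `|r| < 1 by rewrite ger0_norm.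
move=> /cvg_expr/cvgrPdist_lt/(_ _ hc0)[k _ /(_ k (leqnn _))].
rewrite /= sub0r normrN ger0_norm ?exprn_ge0 // => rk.
have [x [x01 hx]] := Hk k.
have /h01/andP[hx0 hx1] := x01.
have := exprn_ge0 k r0; nra.
Qed.

(* The intervals [polar_itv x'] for [x'] near [x] share an interior point [y] of
   [polar_itv x], and [h x' >= h y / r]: hence [h], although not assumed
   continuous, is locally bounded away from 0. *)
Lemma contraction_bounded_below h r a b :
  (forall x, 0 < x < 1 -> 0 < h x) -> 1 <= r ->
  (forall x y, 0 < x < 1 -> polar_itv x y -> h (x ^+ 2) + h y <= r * h x) ->
  0 < a -> b < 1 ->
  exists2 m, 0 < m & forall x, a <= x <= b -> m <= h x.
Proof.
move=> h0 r1 hr a0 b1.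
(* Compactness makes the local lower bounds uniform: it is enough to treat points near a fixed [x]
   together with small [m > 0]. *)
have /compact_near_coveringP cab := @segment_compact R a b.
suff : \forall m \near 0^'+, forall x, [set` `[a, b]] x -> m <= h x.
  move=> near_m.
  have [m [m0 hm]] := @filter_ex _ (0^'+ : set_system R) _ _
    (filterI (nbhs_right_gt 0) near_m).
  by exists m => // x xab; apply: hm; rewrite /= in_itv.
apply: (cab _ _ (fun m x => m <= h x)) => x.
rewrite /= in_itv /= => /andP[ax xb].
have x01 : 0 < x < 1 by rewrite (lt_le_trans a0 ax) (le_lt_trans xb b1).
have /andP[x0 x1] := x01.
have lt := polar_itv_lt x01.
pose y := (x * Num.sqrt (2 - x ^+ 2) + (2 * x - x ^+ 2)) / 2.
have y_gt : x * Num.sqrt (2 - x ^+ 2) < y by rewrite /y; lra.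
have y_lt : y < 2 * x - x ^+ 2 by rewrite /y; lra.
have s0 : 0 <= x * Num.sqrt (2 - x ^+ 2) by rewrite mulr_ge0 ?sqrtr_ge0 ?ltW.
have hy : 0 < h y by apply: h0; nra.
have c1 : (fun z : R => z * Num.sqrt (2 - z ^+ 2)) z @[z --> x]
    --> x * Num.sqrt (2 - x ^+ 2).
  apply: cvgM; first exact: cvg_id.
  apply: (cvg_comp (fun z : R => 2 - z ^+ 2) Num.sqrt).
    by apply: cvgB; [exact: cvg_cst|exact: exprn_continuous].
  exact: sqrt_continuous.
have c2 : (fun z : R => 2 * z - z ^+ 2) z @[z --> x] --> 2 * x - x ^+ 2.
  apply: cvgB; last exact: exprn_continuous.
  by apply: cvgM; [exact: cvg_cst|exact: cvg_id].
have hyr : 0 < h y / r by rewrite divr_gt0 // (lt_le_trans ltr01).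
near=> z m => /=.
have z0 : 0 < z by near: z; exact: lt_nbhsr.
have z1 : z < 1 by near: z; exact: lt_nbhsl.
have zy1 : z * Num.sqrt (2 - z ^+ 2) < y.
  by near: z; move/cvgr_lt : c1; exact.
have zy2 : y < 2 * z - z ^+ 2 by near: z; move/cvgr_gt : c2; exact.
have mh : m < h y / r by near: m; exact: nbhs_right_lt.
have z01 : 0 < z < 1 by rewrite z0.
apply: (le_trans (ltW mh)).
rewrite ler_pdivrMr ?(lt_le_trans ltr01) // mulrC.
apply: le_trans (hr z y z01 _); last by rewrite /polar_itv /= !ltW.
rewrite lerDr ltW // h0 //; apply/andP; split; nra.
Unshelve. all: end_near. Qed.

(** * A power potential near the endpoints 0 and 1 *)

Definition psi (alpha x : R) : R := (x * (1 - x ^+ 2)) `^ alpha.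

Lemma psi_base x : 0 <= x <= 1 -> 0 <= x * (1 - x ^+ 2) <= 1.
Proof. by move=> /andP[x0 x1]; apply/andP; split; nra. Qed.

Lemma psi_itv alpha x : 0 < alpha -> 0 <= x <= 1 -> 0 <= psi alpha x <= 1.
Proof.
move=> a0 /psi_base/andP[p0 p1]; rewrite powR_ge0 /=.
rewrite -[leRHS](_ : 1 `^ alpha = 1); last by rewrite powR1.
by apply: ge0_ler_powR; rewrite ?nnegrE // ltW.
Qed.

(** The base [x * (1 - x ^ 2)] grows by a factor at most [2 * x] from [x] to [x ^ 2], and at most
    [2 * (1 - x ^ 2)] from [x] to [y]. One of [x], [1 - x ^ 2] is at most [eps], the other at most
    1. *)
Lemma psi_step alpha eps x y : 0 < alpha -> 0 <= x <= 1 -> polar_itv x y ->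
  x <= eps \/ 1 - x ^+ 2 <= eps ->
  psi alpha (x ^+ 2) + psi alpha y <= 2 `^ alpha * (1 + eps `^ alpha) * psi alpha x.
Proof.
move=> a0 x01 xy xeps; have a0' := ltW a0.
have [y01 y2x yx] := polar_itv_bounds x01 xy.
have /andP[x0 x1] := x01; have /andP[y0 y1] := y01.
have /andP[p0 p1] := psi_base x01.
have w0 : 0 <= 1 - x ^+ 2 by nra.
have w1 : 1 - x ^+ 2 <= 1 by nra.
have mono (s t : R) : 0 <= s -> s <= t -> s `^ alpha <= t `^ alpha.
  by move=> s0 st; apply: ge0_ler_powR; rewrite ?nnegrE // (le_trans s0).
have H (s c : R) : 0 <= c -> 0 <= s -> s <= x * (1 - x ^+ 2) * (2 * c) ->
    s `^ alpha <= psi alpha x * (2 `^ alpha * c `^ alpha).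
  move=> c0 s0 /(mono _ _ s0); rewrite powRM ?mulr_ge0 //.
  by rewrite (powRM _ _ c0).
have h1 : psi alpha (x ^+ 2) <= psi alpha x * (2 `^ alpha * x `^ alpha).
  apply: H => //; first by have /psi_base/andP[] : 0 <= x ^+ 2 <= 1 by nra.
  rewrite -subr_ge0 (_ : _ - _ = x * (1 - x ^+ 2) * x * (1 - x ^+ 2)); last by ring.
  by rewrite !mulr_ge0.
have h2 : psi alpha y <= psi alpha x * (2 `^ alpha * (1 - x ^+ 2) `^ alpha).
  apply: H => //; first by have /psi_base/andP[] := y01.
  rewrite (_ : _ * (2 * _) = 2 * x * (1 - x ^+ 2) ^+ 2); last by ring.
  by apply: ler_pM => //; nra.
apply: (le_trans (lerD h1 h2)); rewrite -mulrDr -mulrDr mulrC.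
rewrite ler_wpM2r ?powR_ge0 // ler_wpM2l ?powR_ge0 //.
have le1 (s : R) : 0 <= s -> s <= 1 -> s `^ alpha <= 1.
  by move=> s0 /(mono _ _ s0); rewrite powR1.
case: xeps => [/(mono _ _ x0)|/(mono _ _ w0)] le.
  by rewrite addrC lerD // le1.
by rewrite lerD // le1.
Qed.

Lemma scaling_contraction h mu :
  (forall x, 0 < x < 1 -> 0 < h x) ->
  (ereal_sup [set r%:E | r in scaling_ratios h] < (2 `^ (- mu^-1))%:E)%E ->
  exists2 r, r < 2 `^ (1 - mu^-1) &
    forall x y, 0 < x < 1 -> polar_itv x y -> h (x ^+ 2) + h y <= r * h x.
Proof.
move=> h0 sup_lt; have : exists2 s, s < 2 `^ (- mu^-1) &
    forall r, scaling_ratios h r -> r <= s.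
  have hub r : scaling_ratios h r ->
      (r%:E <= ereal_sup [set r%:E | r in scaling_ratios h])%E.
    by move=> hr; apply: ereal_sup_ubound; exists r.
  case: (ereal_sup _) hub sup_lt => [s| |] hub //.
    by rewrite lte_fin => s_lt; exists s => // r /hub; rewrite lee_fin.
  (* A supremum equal to [-oo] would mean that there are no ratios, so any smaller real serves. *)
  move=> _; exists (2 `^ (- mu^-1) - 1) => [|r /hub]; first by rewrite ltrBlDr ltrDl.
  by rewrite leeNy_eq.
move=> [s s_lt hs]; exists (2 * s).
  rewrite powRD ?powRr1 ?ltr_pM2l //.
  by apply/implyP => _; rewrite pnatr_eq0.
move=> x y x01 xy; have hx := h0 x x01.
have := hs ((h (x ^+ 2) + h y) / (2 * h x)).
rewrite ler_pdivrMr ?mulr_gt0 // mulrCA mulrA; apply.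
by exists (x, y).
Qed.

(** The base is [64 = 8 * 8]: at a mixed node both [z] and [1 - z ^ 2] will be at least [8 ^ - n],
    so that [psi alpha z] is at least [64 ^ (- alpha * n)]. *)
Lemma exists_powR_eq (u : R) : 1 < u -> exists2 alpha, 0 < alpha & 64 `^ alpha = u.
Proof.
move=> u1; have l64 : 0 < ln (64 : R) by rewrite ln_gt0 // ltr1n.
exists (ln u / ln 64); first by rewrite divr_gt0 // ln_gt0.
rewrite /powR (negbTE (_ : 64 != 0 :> R)) ?pnatr_eq0 //.
by rewrite divfK ?lt0r_neq0 // lnK // posrE (lt_trans ltr01).
Qed.

(* The term [kappa * psi] keeps [G] away from 0 quantitatively, at a polynomial
   rate; since [psi] itself contracts near 0 and 1 and [h] is bounded below in
   between, a small [kappa] costs nothing. *)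
Lemma exists_potential mu : scaling_exponent_upper_bound mu ->
  exists alpha Lam kappa K : R, exists G : R -> R,
  [/\ 0 < alpha, 1 <= Lam, 64 `^ alpha * Lam < 2 `^ (1 - mu^-1) & 0 < kappa] /\
  (forall x, 0 <= x <= 1 -> kappa * psi alpha x <= G x <= K) /\
  (forall x y, 0 <= x <= 1 -> polar_itv x y -> G (x ^+ 2) + G y <= Lam * G x).
Proof.
move=> [h [h01 [h_0 h_1] h0 sup_lt]].
have [r rB hr] := scaling_contraction h0 sup_lt.
set B := 2 `^ _ in rB *.
have r1 : 1 <= r.
  apply: ge1_contraction hr => x x01; rewrite h0 //=.
  by have /h01/andP[] : 0 <= x <= 1 by move/andP: x01 => [x0 x1]; rewrite !ltW.
pose Lam := (r + B) / 2.
have rL : r < Lam by rewrite /Lam; lra.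
have LB : Lam < B by rewrite /Lam; lra.
have L1 : 1 < Lam by apply: le_lt_trans rL.
have L0 : 0 < Lam by apply: lt_trans L1.
(* [u] lies strictly between 1 and both [B / Lam] and [Lam]: the first bound leaves room for the
   factor [64 ^ alpha = u] below [B], the second makes [eps] positive. *)
pose u := Num.min ((1 + B / Lam) / 2) ((1 + Lam) / 2).
have BL1 : 1 < B / Lam by rewrite ltr_pdivlMr // mul1r.
have u1 : 1 < u by rewrite lt_min; apply/andP; split; lra.
have uB : u < B / Lam by rewrite gt_min; apply/orP; left; lra.
have uL : u < Lam by rewrite gt_min; apply/orP; right; lra.
have u0 : 0 < u by apply: lt_trans u1.
have [alpha a0 au] := exists_powR_eq u1.
have a0' := ltW a0.
(* Solves [u * (1 + eps ^ alpha) = Lam]; since [2 ^ alpha <= u], [psi] contracts by [Lam] wherever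
   [psi_step] applies. *)
pose eps := (Lam / u - 1) `^ alpha^-1.
have Lu : 0 < Lam / u - 1 by rewrite subr_gt0 ltr_pdivlMr // mul1r.
have eps0 : 0 < eps by rewrite powR_gt0.
have epsE : eps `^ alpha = Lam / u - 1.
  by rewrite /eps -powRrM mulVf ?lt0r_neq0 // powRr1 // ltW.
have b1 : 1 - eps / 2 < 1 by lra.
have [m m0 hm] := contraction_bounded_below h0 r1 hr eps0 b1.
(* In the middle region [h >= m], so the slack [(Lam - r) * h x] is at least [2 * kappa], which pays
   for both [psi] terms. *)
pose kappa := (Lam - r) * m / 2.
have k0 : 0 < kappa by rewrite /kappa divr_gt0 // mulr_gt0 // subr_gt0.
exists alpha, Lam, kappa, (1 + kappa), (fun x => h x + kappa * psi alpha x).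
split; last split.
- split=> //; first exact: ltW.
  by rewrite au -ltr_pdivlMr.
- move=> x x01; have /andP[hx0 hx1] := h01 x x01.
  have /andP[p0 p1] := psi_itv a0 x01.
  by apply/andP; split; nra.
move=> x y x01 xy; have [y01 y2x yx] := polar_itv_bounds x01 xy.
have /andP[x0 x1] := x01; have /andP[y0 y1] := y01.
have hx0 : 0 <= h x by have /andP[] := h01 x x01.
have xx01 : 0 <= x ^+ 2 <= 1 by apply/andP; split; nra.
have /andP[p0 p1] := psi_itv a0 x01.
have /andP[py0 py1] := psi_itv a0 y01.
have /andP[px0 px1] := psi_itv a0 xx01.
(* [hr] covers only the open interval; at 0 and 1 the interval of [y] is a single point where [h]
   vanishes. *)
have hstep : h (x ^+ 2) + h y <= r * h x.
  have [x00|xN0] := eqVneq x 0.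
    have -> : y = 0 by apply/eqP; rewrite eq_le y0 andbT; move: y2x; rewrite x00 mulr0.
    by rewrite x00 expr0n /= h_0 mulr0 addr0.
  have [x11|xN1] := eqVneq x 1.
    have -> : y = 1 by move: yx; rewrite x11; nra.
    by rewrite x11 expr1n h_1 mulr0 addr0.
  by apply: hr; rewrite // lt_neqAle eq_sym xN0 x0 lt_neqAle xN1.
have [xe|ex] := boolP ((x <= eps) || (1 - x ^+ 2 <= eps)).
  have pstep := psi_step a0 x01 xy (orP xe).
  have au2 : 2 `^ alpha <= u.
    by rewrite -au ge0_ler_powR ?nnegrE // ler_nat.
  rewrite epsE subrKC in pstep.
  have : 2 `^ alpha * (Lam / u) <= Lam.
    by rewrite mulrA ler_pdivrMr // mulrC ler_pM2l.
  move=> /(ler_wpM2r p0)/(le_trans pstep)/(ler_wpM2l (ltW k0)).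
  nra.
move: ex; rewrite negb_or -!ltNge => /andP[xe xe'].
have hmx : m <= h x.
  by apply: hm; rewrite ltW //=; nra.
have e1 : kappa * psi alpha (x ^+ 2) <= kappa by nra.
have e2 : kappa * psi alpha y <= kappa by nra.
have e3 : 0 <= Lam * (kappa * psi alpha x).
  by apply: mulr_ge0; [exact: ltW|apply: mulr_ge0 => //; exact: ltW].
have e4 : 2 * kappa <= (Lam - r) * h x by rewrite /kappa; nra.
nra.
Qed.

End Potential.

(** * Averages over bit strings *)

Section BitAverage.
Variable R : realType.
Implicit Types (f g : seq bool -> R) (d : nat).

(** Expectation over [d] fair bits. Recursion on the first bit makes the splitting into consecutive
    blocks, [bavg_cat], immediate. *)
Fixpoint bavg d f : R :=
  if d is d'.+1
  then (bavg d' (fun v => f (true :: v)) + bavg d' (fun v => f (false :: v))) / 2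
  else f [::].

Lemma le_bavg d f g :
  (forall v, size v = d -> f v <= g v) -> bavg d f <= bavg d g.
Proof.
elim: d f g => [|d IH] f g fg /=; first exact: fg.
by rewrite ler_pM2r ?invr_gt0 // lerD // IH // => v dv; rewrite fg //= dv.
Qed.

Lemma eq_bavg d f g :
  (forall v, size v = d -> f v = g v) -> bavg d f = bavg d g.
Proof. by move=> fg; apply/eqP; rewrite eq_le !le_bavg // => v /fg ->. Qed.

Lemma bavg_cst d (c : R) : bavg d (fun=> c) = c.
Proof. by elim: d => //= d ->; field. Qed.

Lemma bavgD d f g : bavg d (fun v => f v + g v) = bavg d f + bavg d g.
Proof. by elim: d f g => //= d IH f g; rewrite !IH; field. Qed.

Lemma bavgZ d (c : R) f : bavg d (fun v => c * f v) = c * bavg d f.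
Proof. by elim: d f => //= d IH f; rewrite !IH; field. Qed.

Lemma bavg_cat a b f :
  bavg (a + b) f = bavg a (fun u => bavg b (fun v => f (u ++ v))).
Proof. by elim: a f => //= a IH f; rewrite !IH. Qed.

Lemma bavg_rcons d f :
  bavg d.+1 f = bavg d (fun u => (f (rcons u true) + f (rcons u false)) / 2).
Proof.
rewrite -addn1 bavg_cat; apply: eq_bavg => u _ /=.
by rewrite !cats1.
Qed.

Lemma bavg_ge0 d f : (forall v, 0 <= f v) -> 0 <= bavg d f.
Proof. by move=> f0; rewrite -(bavg_cst d 0) le_bavg. Qed.

Lemma sum_tuple_bool d f :
  \sum_(v : d.-tuple bool) f v = 2 ^+ d * bavg d f.
Proof.
elim: d f => [|d IH] f.
  rewrite expr0 mul1r (bigD1 [tuple]) //= big1 ?addr0 // => v.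
  by case/negP; apply/eqP; rewrite [v]tuple0; apply: val_inj.
pose cons_pair (p : bool * d.-tuple bool) : d.+1.-tuple bool :=
  [tuple of p.1 :: p.2].
rewrite (reindex cons_pair) /=; last first.
  exists (fun v => (thead v, [tuple of behead v])) => [[b v] _|v _] /=.
    by rewrite theadE; congr pair; apply: val_inj.
  by rewrite [RHS]tuple_eta; apply: val_inj.
rewrite -(pair_big xpredT xpredT (fun b (v : d.-tuple bool) => f (b :: v))) /=.
rewrite big_bool /= (IH (fun v => f (true :: v))) (IH (fun v => f (false :: v))).
by rewrite exprS; field.
Qed.

(** Generating function of a binomial count, the source of the Chernoff bounds below. *)
Lemma bavg_count d (b : bool) (w : R) :
  bavg d (fun v => w ^+ count_mem b v) = ((1 + w) / 2) ^+ d.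
Proof.
elim: d => [|d IH] //; rewrite exprS -IH /=.
have H c : bavg d (fun v => w ^+ ((c == b) + count_mem b v))
         = w ^+ (c == b) * bavg d (fun v => w ^+ count_mem b v).
  by rewrite -bavgZ; apply: eq_bavg => v _; rewrite exprD.
by rewrite !H; case: b {IH H}; rewrite /= expr0 expr1; field.
Qed.

(** A union bound over three consecutive blocks when [f] is an indicator. *)
Lemma bavg_cat3_le a b c (f f1 f2 f3 : seq bool -> R) :
  (forall u v w, size u = a -> size v = b -> size w = c ->
    f (u ++ v ++ w) <= f1 u + f2 v + f3 w) ->
  bavg (a + (b + c)) f <= bavg a f1 + bavg b f2 + bavg c f3.
Proof.
move=> fle; rewrite bavg_cat.
rewrite -[leRHS](bavg_cst a) -addrA.
apply: (@le_trans _ _ (bavg a (fun u => f1 u + (bavg b f2 + bavg c f3)))); last first.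
  by rewrite bavgD !bavg_cst.
apply: le_bavg => u ua; rewrite bavg_cat.
apply: (@le_trans _ _ (bavg b (fun v => f1 u + (f2 v + bavg c f3)))); last first.
  by rewrite !bavgD !bavg_cst.
apply: le_bavg => v vb.
apply: (@le_trans _ _ (bavg c (fun w => f1 u + (f2 v + f3 w)))); last first.
  by rewrite !bavgD !bavg_cst.
by apply: le_bavg => w wc; rewrite addrA fle.
Qed.

Lemma bavg_contraction (G : seq bool -> R) (Lam : R) d : 0 <= Lam ->
  (forall v, G (rcons v true) + G (rcons v false) <= Lam * G v) ->
  bavg d G <= (Lam / 2) ^+ d * G [::].
Proof.
move=> L0 HG; elim: d => [|d IH]; first by rewrite expr0 mul1r.
rewrite bavg_rcons; apply: (@le_trans _ _ (bavg d (fun v => Lam / 2 * G v))).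
  by apply: le_bavg => v _; rewrite mulrAC ler_pM2r ?invr_gt0.
by rewrite bavgZ exprS -[leRHS]mulrA ler_wpM2l // divr_ge0.
Qed.

(* Each [b] squares [X] and each other bit at most doubles it; spending the
   doublings first is the worst case, whence the exponent. *)
Lemma square_double_bound (X : seq bool -> R) (b : bool) (u w : seq bool) m :
  (forall v, 0 <= X v <= 1) ->
  (forall v, X (rcons v b) <= X v ^+ 2) ->
  (forall v, X (rcons v (~~ b)) <= 2 * X v) ->
  X u <= 2^-1 ^+ m ->
  X (u ++ w) <= 2^-1 ^+ (2 ^ count_mem b w * (m - size w)).
Proof.
move=> X01 Xsq Xdbl Xu; have half01 : 0 <= (2^-1 : R) <= 1 by lra.
have /andP[half0 half1] := half01.
elim/last_ind: w => [|w c IH]; first by rewrite cats0 subn0 mul1n.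
rewrite -rcons_cat size_rcons.
have -> : count_mem b (rcons w c) = (count_mem b w + (c == b))%N.
  by rewrite -cats1 count_cat /= addn0.
have [cb|cb] := eqVneq c b.
  rewrite cb; apply: (le_trans (Xsq _)).
  have /andP[x0 x1] := X01 (u ++ w).
  apply: (@le_trans _ _ ((2^-1 ^+ (2 ^ count_mem b w * (m - size w))) ^+ 2)).
    by rewrite ler_pXn2r // nnegrE exprn_ge0 // ltW.
  rewrite -exprM ler_wiXn2l //.
  rewrite expnD expn1 mulnAC leq_mul2r leq_mul2l.
  by apply/orP; right; apply/orP; right; lia.
have -> : c = ~~ b by case: (c) (b) cb => [] [].
rewrite addn0.
(* The subtraction is truncated: once [size w >= m], the exponent is 0 and the claim is only
   [X <= 1]. *)
have [e0|e_gt0] := posnP (m - size w).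
  rewrite (_ : (m - (size w).+1)%N = 0%N) ?muln0 ?expr0; last by lia.
  by have /andP[] := X01 (rcons (u ++ w) (~~ b)).
apply: (le_trans (Xdbl _)).
apply: (@le_trans _ _ (2 * 2^-1 ^+ (2 ^ count_mem b w * (m - size w)))).
  by rewrite ler_pM2l.
set j := (2 ^ _)%N in IH *; have j0 : (0 < j)%N by rewrite expn_gt0.
(* One factor 1/2 pays for the doubling; the exponent was allowed to drop by [j >= 1]. *)
have -> : (j * (m - size w) = (j * (m - size w)).-1.+1)%N.
  by rewrite prednK // muln_gt0 j0.
rewrite exprS mulrA mulfV // mul1r ler_wiXn2l //.
rewrite subnS; move: (m - size w)%N e_gt0 => [//|e] _ /=.
by rewrite mulnS; lia.
Qed.

End BitAverage.

(** * Unpolarized nodes of a polarization process *)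

Section PolarProcess.
Variable R : realType.
Implicit Types (z : seq bool -> R) (P : pred (seq bool)).

Definition polar_process z : Prop :=
  [/\ forall v, 0 <= z v <= 1, forall v, z (rcons v true) = z v ^+ 2 &
      forall v, polar_itv (z v) (z (rcons v false))].

Lemma polar_process_psi z alpha Lam kappa K (G : R -> R) d :
  polar_process z -> 0 < alpha -> 1 <= Lam -> 0 < kappa ->
  (forall x, 0 <= x <= 1 -> kappa * psi alpha x <= G x <= K) ->
  (forall x y, 0 <= x <= 1 -> polar_itv x y -> G (x ^+ 2) + G y <= Lam * G x) ->
  bavg d (fun v => psi alpha (z v)) <= K / kappa * (Lam / 2) ^+ d.
Proof.
move=> [z01 zt zf] a0 L1 k0 HG Hstep; have L0 : 0 <= Lam by apply: le_trans L1.
have step v : G (z (rcons v true)) + G (z (rcons v false)) <= Lam * G (z v).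
  by rewrite zt; apply: Hstep.
have := bavg_contraction (G := G \o z) d L0 step.
have : kappa * bavg d (fun v => psi alpha (z v)) <= bavg d (G \o z).
  by rewrite -bavgZ; apply: le_bavg => v _ /=; have /HG/andP[] := z01 v.
move=> h1 h2; rewrite mulrAC ler_pdivlMr // mulrC.
apply: (le_trans h1); apply: (le_trans h2); rewrite /= mulrC.
rewrite ler_wpM2r // ?exprn_ge0 ?divr_ge0 //.
by have /HG/andP[] := z01 [::].
Qed.

(** After [v] the exponent is at least [2 ^ J * (2 * t - t) >= r.+1 * t]. The block [w] uses up at
    most [r * t] of it before its squarings act, which leaves [t >= 1]. *)
Lemma two_block_bound (X : seq bool -> R) (b : bool) (u v w : seq bool) t r J :
  (forall v, 0 <= X v <= 1) ->
  (forall v, X (rcons v b) <= X v ^+ 2) ->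
  (forall v, X (rcons v (~~ b)) <= 2 * X v) ->
  X u <= 2^-1 ^+ (2 * t) -> size v = t -> size w = (r * t)%N -> (0 < t)%N ->
  (J <= count_mem b v)%N -> (r < 2 ^ J)%N ->
  X (u ++ v ++ w) <= 2^-1 ^+ (2 ^ count_mem b w).
Proof.
move=> X01 Xsq Xdbl Xu sv sw t0 Jv rJ.
have half0 : 0 <= (2^-1 : R) by lra.
have half1 : (2^-1 : R) <= 1 by lra.
have rv : (r < 2 ^ count_mem b v)%N.
  by apply: (leq_trans rJ); rewrite leq_exp2l.
have Xuv : X (u ++ v) <= 2^-1 ^+ (r.+1 * t).
  apply: le_trans (square_double_bound v X01 Xsq Xdbl Xu) _.
  rewrite ler_wiXn2l // sv leq_mul //; lia.
rewrite catA; apply: le_trans (square_double_bound w X01 Xsq Xdbl Xuv) _.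
rewrite ler_wiXn2l // sw -mulnBl subSn // subnn mul1n leq_pmulr //.
Qed.

(* A string is cut into blocks [u], [v], [w]: [u] makes [z] or [1 - z ^ 2] at most
   [2 ^ (- 2 t)]; the [J] squarings in [v] then compensate for all the doublings in
   [w], so that [j] squarings in [w] give [2 ^ (- 2 ^ j)]. *)
Lemma three_block_avg z P alpha A w n q r J t :
  polar_process z -> 0 < alpha -> (r < 2 ^ J)%N -> (0 < t)%N ->
  0 <= A -> 0 <= w -> (forall j, (2 ^ j <= 3 * n)%N -> 1 <= A * w ^+ j) ->
  (forall v, size v = (q * t + (t + r * t))%N -> P v ->
    2^-1 ^+ (3 * n) <= z v /\ 2^-1 ^+ (3 * n) <= 1 - z v ^+ 2) ->
  bavg (q * t + (t + r * t)) (fun v => (P v)%:R) <=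
    (16 `^ alpha) ^+ t * bavg (q * t) (fun v => psi alpha (z v))
    + 2 * 2 ^+ J * (3 / 4) ^+ t + 2 * A * ((1 + w) / 2) ^+ (r * t).
Proof.
move=> [z01 zt zf] a0 rJ t0 A0 w0 hA hP.
have half0 : 0 <= (2^-1 : R) by lra.
have two0 : 0 <= (2 : R) by lra.
have half1 : (2^-1 : R) < 1 by lra.
(* Exponential majorants of three bad events: [u] leaves the process unpolarized, [v] has fewer than
   [J] bits of one kind, [w] has too few bits of one kind. *)
pose F1 u := (16 `^ alpha) ^+ t * psi alpha (z u).
pose F2 (v : seq bool) := 2 ^+ J * 2^-1 ^+ count_mem true v
   + 2 ^+ J * 2^-1 ^+ count_mem false v : R.
pose F3 (v : seq bool) := A * w ^+ count_mem true v + A * w ^+ count_mem false v.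
have F10 u : 0 <= F1 u by rewrite mulr_ge0 ?exprn_ge0 ?powR_ge0.
have F20 v : 0 <= F2 v by rewrite addr_ge0 // mulr_ge0 ?exprn_ge0.
have F30 v : 0 <= F3 v by rewrite addr_ge0 // mulr_ge0 ?exprn_ge0.
have F2E : bavg t F2 = 2 * 2 ^+ J * (3 / 4) ^+ t.
  rewrite bavgD !bavgZ !bavg_count (_ : (1 + 2^-1) / 2 = 3 / 4 :> R); first by ring.
  by field.
have F3E : bavg (r * t) F3 = 2 * A * ((1 + w) / 2) ^+ (r * t).
  by rewrite bavgD !bavgZ !bavg_count; ring.
rewrite -F2E -F3E -bavgZ; apply: bavg_cat3_le => u v x su sv sx.
case: (boolP (P _)) => [/hP|_]; last first.
  exact: addr_ge0 (addr_ge0 (F10 u) (F20 v)) (F30 x).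
rewrite !size_cat su sv sx => /(_ erefl) [hz hy].
have main (X : seq bool -> R) (b : bool) :
    (forall v, 0 <= X v <= 1) ->
    (forall v, X (rcons v b) <= X v ^+ 2) ->
    (forall v, X (rcons v (~~ b)) <= 2 * X v) ->
    X u <= 2^-1 ^+ (2 * t) -> 2^-1 ^+ (3 * n) <= X (u ++ v ++ x) ->
    1 <= F2 v + F3 x.
  move=> X01 Xsq Xdbl Xu Xl.
  have [Jv|vJ] := leqP J (count_mem b v).
    apply: (@le_trans _ _ (F3 x)); last by rewrite lerDr.
    have /hA hAj : (2 ^ count_mem b x <= 3 * n)%N.
      rewrite -(@ler_iXn2l R 2^-1) ?invr_gt0 //.
      apply: le_trans Xl _; exact: two_block_bound sv sx t0 Jv rJ.
    apply: le_trans hAj _; rewrite /F3.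
    by case: b {Xsq Xdbl Jv}; rewrite ?lerDl ?lerDr mulr_ge0 ?exprn_ge0.
  apply: (@le_trans _ _ (F2 v)); last by rewrite lerDl.
  have : 1 <= 2 ^+ J * 2^-1 ^+ count_mem b v :> R.
    rewrite exprVn ler_pdivlMr ?exprn_gt0 // mul1r ler_weXn2l ?ler1n //.
    exact: ltnW.
  move=> h; apply: le_trans h _; rewrite /F2.
  by case: b {Xsq Xdbl vJ}; rewrite ?lerDl ?lerDr mulr_ge0 ?exprn_ge0.
clearbody F2 F3.
(* Either [z u] is small, and [true] bits square it; or [1 - z u ^ 2] is small, and [false] bits
   square it; or both exceed [4 ^ - t], their product exceeds [16 ^ - t], and [F1 u >= 1]. *)
have [zu|zu] := leP (z u) (2^-1 ^+ (2 * t)).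
  rewrite -addrA; apply: (@le_trans _ _ (F2 v + F3 x)); last by rewrite lerDr F10.
  apply: (main z true) => // y /=; first by rewrite zt.
  by have [] := polar_itv_bounds (z01 y) (zf y).
have [yu|yu] := leP (1 - z u ^+ 2) (2^-1 ^+ (2 * t)).
  rewrite -addrA; apply: (@le_trans _ _ (F2 v + F3 x)); last by rewrite lerDr F10.
  apply: (main (fun s => 1 - z s ^+ 2) false) => // y /=.
  - by have /andP[y0 y1] := z01 y; apply/andP; split; nra.
  - by have [] := polar_itv_bounds (z01 y) (zf y).
  - by rewrite zt; have /andP[y0 y1] := z01 y; have := sqr_ge0 (z y ^+ 2 - 1); nra.
rewrite -addrA; apply: (@le_trans _ _ (F1 u)); last first.
  by rewrite lerDl; exact: addr_ge0 (F20 v) (F30 x).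
rewrite /F1 /psi -powR_mulrn ?powR_ge0 // powRAC -powRM ?powR_ge0 //; last first.
  by have /psi_base/andP[] := z01 u.
rewrite powR_mulrn // -[leLHS](_ : 1 `^ alpha = 1); last by rewrite powR1.
have zy : 1 <= 16 ^+ t * (z u * (1 - z u ^+ 2)).
  rewrite [leLHS](_ : 1 = 16 ^+ t * (2^-1 ^+ (2 * t) * 2^-1 ^+ (2 * t))); last first.
    rewrite -exprD -mulnDl exprM -exprMn (_ : 16 * _ = 1) ?expr1n //.
    by field.
  by rewrite ler_wpM2l ?exprn_ge0 // ler_pM ?exprn_ge0 // ltW.
apply: ge0_ler_powR; rewrite ?nnegrE // ?(ltW a0) //.
exact: le_trans zy.
Qed.

End PolarProcess.

(** * Summing the proportions of unpolarized nodes *)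

Section SumUnpolarized.
Variable R : realType.
Implicit Types (z : seq bool -> R) (P : pred (seq bool)).

Lemma sum_geom_le (s : R) m : 0 <= s -> s < 1 ->
  \sum_(i < m) s ^+ i <= (1 - s)^-1.
Proof.
move=> s0 s1; rewrite -[leRHS]mul1r ler_pdivlMr ?subr_gt0 // mulrC.
rewrite -opprB mulNr -subrX1 opprB gerBl.
exact: exprn_ge0.
Qed.

Lemma sum_divn (g : nat -> R) K n : (0 < K)%N ->
  \sum_(d < K * n) g (d %/ K)%N = K%:R * \sum_(t < n) g t.
Proof.
move=> K0; rewrite -(big_mkord xpredT (fun d => g (d %/ K)%N)).
rewrite -(big_mkord xpredT g).
elim: n => [|n IH]; first by rewrite muln0 !big_geq // mulr0.
rewrite mulnS addnC (big_cat_nat (n := K * n)) //=; last exact: leq_addr.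
rewrite IH big_nat_recr //= mulrDr; congr (_ + _).
rewrite -{1}[(K * n)%N]add0n big_addn addKn.
rewrite (eq_big_nat _ _ (F2 := fun=> g n)).
  by rewrite big_const_nat subn0 iter_addr addr0 mulr_natl.
move=> i /andP[_ iK]; congr g.
by rewrite mulnC divnDMl // divn_small.
Qed.

(** The ratio of the two logarithms tends to 2 as [w] tends to 1. This is the origin of the factor 2
    in the second term of the latency: about half of the bits are squarings. *)
Lemma chernoff_ratio (delta : R) : 0 < delta ->
  exists w : R, 0 < w < 1 /\ - ln w <= (2 + delta) * - ln ((1 + w) / 2).
Proof.
move=> d0; pose w := 2 / (2 + delta); exists w.
have D0 : 0 < 2 + delta by lra.
have w0 : 0 < w by rewrite divr_gt0.
have w1 : w < 1 by rewrite ltr_pdivrMr //; lra.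
split; first by rewrite w0.
have h1 : - ln w <= delta / 2.
  rewrite -lnV ?posrE // (_ : w^-1 = 1 + delta / 2); last first.
    by rewrite invf_div mulrDl divff.
  by apply: le_ln1Dx; lra.
have h2 : ln ((1 + w) / 2) <= (w - 1) / 2.
  rewrite (_ : (1 + w) / 2 = 1 + (w - 1) / 2); last by field.
  by apply: le_ln1Dx; lra.
apply: (le_trans h1).
have -> : delta / 2 = (2 + delta) * - ((w - 1) / 2).
  by rewrite /w; field; rewrite lt0r_neq0.
by rewrite ler_pM2l // lerN2.
Qed.

Lemma sum_bavg_le z alpha C0 lam : polar_process z -> 0 < alpha ->
  0 <= lam -> lam < 1 ->
  (forall d, bavg d (fun v => psi alpha (z v)) <= C0 * lam ^+ d) ->
  forall delta : R, 0 < delta -> exists C : R, forall n P, (0 < n)%N ->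
  (forall u w, P (u ++ w) -> P u) ->
  (forall v, (size v < n)%N -> P v ->
    2^-1 ^+ (3 * n) <= z v /\ 2^-1 ^+ (3 * n) <= 1 - z v ^+ 2) ->
  \sum_(d < n) bavg d (fun v => (P v)%:R) <= (2 + delta) * log2 n%:R + C.
Proof.
(* With [t = d %/ K], blocks of lengths [q t], [t] and [r t]; [r] is so large that
   [K / r] is close to 1. *)
move=> zp a0 l0 l1 hpsi delta d0.
have C0_ge0 : 0 <= C0.
  have := hpsi 0%N; rewrite expr0 mulr1 /=; apply: le_trans.
  exact: powR_ge0.
have [w [/andP[w0 w1] hw]] := chernoff_ratio (divr_gt0 d0 (ltr0n R 2)).
(* With [q * t] initial steps, the decay of [psi] beats the loss [16 ^ (alpha * t)] and leaves
   [2 ^ - t]. *)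
have [q hq] : exists q, 16 `^ alpha * lam ^+ q <= 2^-1.
  have p0 : 0 < (16 : R) `^ alpha by rewrite powR_gt0.
  have e0 : 0 < 2^-1 / (16 : R) `^ alpha by rewrite divr_gt0 // invr_gt0.
  have : `|lam| < 1 by rewrite ger0_norm.
  move=> /cvg_expr/cvgrPdist_lt/(_ _ e0)[k _ /(_ k (leqnn _))].
  rewrite /= sub0r normrN ger0_norm ?exprn_ge0 // => lk.
  by exists k; rewrite mulrC -ler_pdivlMr // ltW.
pose D := 2 + delta / 2.
have D0 : 0 < D by rewrite /D; lra.
(* This gives [D * K <= (2 + delta) * r], so that the blocks [u] and [v] cost only another
   [delta / 2]. *)
have [r r0 hr] : exists2 r, (0 < r)%N & D * q.+1%:R <= delta / 2 * r%:R.
  exists (Num.truncn (D * q.+1%:R / (delta / 2))).+1 => //.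
  by rewrite -ler_pdivrMl ?divr_gt0 // [leLHS]mulrC ltW // truncnS_gt.
pose K := (q + (1 + r))%N.
have K0 : (0 < K)%N by rewrite ltn_addl.
pose x := (1 + w) / 2.
have x0 : 0 < x by rewrite /x; lra.
have x1 : x < 1 by rewrite /x; lra.
pose s := Num.max (3 / 4) (x ^+ r).
have s1 : s < 1.
  rewrite gt_max; apply/andP; split; first lra.
  by rewrite exprn_ilt1 ?(ltW x0) // -lt0n.
have s34 : 3 / 4 <= s by rewrite le_max lexx.
have sx : x ^+ r <= s by rewrite le_max lexx orbT.
have s0 : 0 < s by apply: lt_le_trans s34; lra.
pose C2 : R := 2 * 2 ^+ r.
have C2_ge0 : 0 <= C2 by rewrite mulr_ge0 // exprn_ge0.
pose C := C0 + C2 + 2.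
have C_ge0 : 0 <= C by rewrite /C; lra.
exists ((2 + delta) * log2 3 + K%:R + K%:R * (C / (1 - s))).
move=> n P n0 Ppre hP.
have ln2 : 0 < ln (2 : R) by rewrite ln_gt0 // ltr1n.
have lx : 0 < - ln x by rewrite oppr_gt0 ln_lt0 // x0.
have lw : 0 < - ln w by rewrite oppr_gt0 ln_lt0 // w0.
pose a := - ln w / ln 2.
have aw : 2 `^ a = w^-1.
  rewrite /powR pnatr_eq0 /= /a divfK ?lt0r_neq0 // expRN lnK //.
have ag0 : 0 < a by rewrite divr_gt0.
(* As [w = 2 ^ - a], the weight [A * w ^+ j] is at least 1 as soon as [2 ^ j <= 3 * n]. *)
pose A := (3 * n)%:R `^ a.
have n31 : 1 <= (3 * n)%:R :> R by rewrite ler1n muln_gt0.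
have A0 : 0 < A by rewrite powR_gt0 // (lt_le_trans ltr01).
have lA : ln A = a * ln (3 * n)%:R by rewrite ln_powR.
have lA0 : 0 <= ln A by rewrite lA mulr_ge0 ?(ltW ag0) // ln_ge0.
have hA j : (2 ^ j <= 3 * n)%N -> 1 <= A * w ^+ j.
  move=> j3; rewrite -ler_pdivrMr ?exprn_gt0 // mul1r -exprVn -aw.
  rewrite -powR_mulrn ?powR_ge0 // powRAC powR_mulrn //.
  rewrite ge0_ler_powR ?nnegrE ?exprn_ge0 ?ler0n ?(ltW ag0) //.
  by rewrite -natrX ler_nat.
have rR0 : 0 < r%:R :> R by rewrite ltr0n.
have L0 : 0 < r%:R * - ln x by rewrite mulr_gt0.
have [T T0 [T1 T2]] : exists2 T, (0 < T)%N & ln A <= T%:R * (r%:R * - ln x) /\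
    T%:R <= ln A / (r%:R * - ln x) + 1.
  exists (Num.truncn (ln A / (r%:R * - ln x))).+1 => //; split.
    by rewrite -ler_pdivrMr // ltW // truncnS_gt.
  by rewrite -natr1 lerD2r truncn_le // divr_ge0 // ltW.
have AT : A * (x ^+ r) ^+ T <= 1.
  rewrite -ler_ln ?posrE ?mulr_gt0 ?exprn_gt0 // ln1.
  rewrite lnM ?posrE ?exprn_gt0 // -exprM lnXn // -mulr_natr natrM.
  by move: T1; nra.
(* The first [T] values of [t] are bounded by 1 and produce the logarithm. From [T] on, [A] is
   compensated by [x ^ (r * T)] and a geometric tail remains. *)
pose g t := if (t < T)%N then 1 else C * s ^+ (t - T).
have g0 t : 0 <= g t.
  rewrite /g; case: ifP => // _; apply: mulr_ge0 => //.
  by rewrite exprn_ge0 // ltW.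
have pg (d : nat) : (d < n)%N -> bavg d (fun v => (P v)%:R) <= g (d %/ K)%N.
  move=> dn; set t := (d %/ K)%N.
  have Ktd : (K * t <= d)%N by rewrite mulnC leq_trunc_div.
  have p1 e : bavg e (fun v => (P v)%:R) <= 1.
    by rewrite -[leRHS](bavg_cst e) le_bavg // => v _; case: (P v).
  rewrite /g; case: ltnP => // Tt.
  have -> : d = (K * t + (d - K * t))%N by rewrite subnKC.
  (* [P] is inherited by prefixes, so the depth may be rounded down to a multiple of [K]. *)
  apply: (@le_trans _ _ (bavg (K * t) (fun v => (P v)%:R))).
    rewrite bavg_cat; apply: le_bavg => u _.
    rewrite -[leRHS](bavg_cst (d - K * t)); apply: le_bavg => v _.
    rewrite ler_nat; move: (Ppre u v).
    by case: (P (u ++ v)) => // ->.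
  have t0 : (0 < t)%N by apply: leq_trans Tt.
  have KtE : (K * t = q * t + (t + r * t))%N by rewrite /K !mulnDl mul1n.
  have hP' v : size v = (q * t + (t + r * t))%N -> P v ->
      2^-1 ^+ (3 * n) <= z v /\ 2^-1 ^+ (3 * n) <= 1 - z v ^+ 2.
    by move=> sv; apply: hP; rewrite sv -KtE (leq_ltn_trans Ktd).
  rewrite KtE.
  have rJ : (r < 2 ^ r)%N by rewrite ltn_expl.
  apply: le_trans (three_block_avg zp a0 rJ t0 (ltW A0) (ltW w0) hA hP') _.
  rewrite -/x -/C2.
  have st c : 0 <= c -> c <= s -> c ^+ t <= s ^+ (t - T).
    move=> c0 cs; apply: (@le_trans _ _ (s ^+ t)).
      by rewrite ler_pXn2r ?nnegrE // ltW.
    by rewrite ler_wiXn2l ?leq_subr // ltW.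
  have e1 : 16 `^ alpha ^+ t * bavg (q * t) (fun v => psi alpha (z v))
      <= C0 * s ^+ (t - T).
    apply: (@le_trans _ _ (C0 * 2^-1 ^+ t)); last first.
      by rewrite ler_wpM2l // st // (le_trans _ s34) //; lra.
    have := hpsi (q * t)%N => /(ler_wpM2l (exprn_ge0 t (powR_ge0 16 alpha))).
    move=> h; apply: (le_trans h); rewrite mulrCA ler_wpM2l // exprM -exprMn.
    by rewrite ler_pXn2r ?nnegrE ?mulr_ge0 ?powR_ge0 ?exprn_ge0 ?invr_ge0.
  have e2 : C2 * (3 / 4) ^+ t <= C2 * s ^+ (t - T).
    by rewrite ler_wpM2l // st.
  have e3 : 2 * A * x ^+ (r * t) <= 2 * s ^+ (t - T).
    rewrite -mulrA ler_pM2l // exprM -{1}(subnKC Tt) exprD mulrA.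
    rewrite -[leRHS]mul1r ler_pM // ?mulr_ge0 ?exprn_ge0 ?(ltW A0) ?(ltW x0) //.
    by rewrite lerXn2r ?nnegrE ?exprn_ge0 ?(ltW x0) ?(ltW s0).
  by rewrite /C (mulrDl (C0 + C2)) (mulrDl C0); exact: lerD (lerD e1 e2) e3.
have sumg : \sum_(d < n) bavg d (fun v => (P v)%:R) <= K%:R * (T%:R + C / (1 - s)).
  apply: (@le_trans _ _ (\sum_(d < n) g (d %/ K)%N)).
    by apply: ler_sum => d _; apply: pg.
  apply: (@le_trans _ _ (\sum_(d < K * (T + n)) g (d %/ K)%N)).
    rewrite -!(big_mkord xpredT (fun d => g (d %/ K)%N)).
    rewrite [leRHS](big_cat_nat (n := n)) //=; last first.
      exact: leq_trans (leq_addl T n) (leq_pmull _ K0).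
    by rewrite lerDl sumr_ge0.
  rewrite sum_divn // ler_wpM2l //.
  rewrite big_split_ord /= lerD //.
    rewrite (eq_bigr (fun=> 1)) => [|i _]; last by rewrite /g ltn_ord.
    by rewrite sumr_const card_ord.
  rewrite (eq_bigr (fun i : 'I_n => C * s ^+ i)) => [|i _]; last first.
    by rewrite /g ltnNge leq_addr /= addKn.
  by rewrite -mulr_sumr ler_wpM2l // sum_geom_le // ltW.
apply: (le_trans sumg); rewrite mulrDr [leRHS]addrA lerD2r.
have := ler_wpM2l (ler0n R K) T2; move=> h; apply: (le_trans h).
rewrite mulrDr mulr1 [leRHS]addrA lerD2r.
have -> : log2 3 = ln 3 / ln 2 :> R by [].
have -> : log2 n%:R = ln n%:R / ln 2 :> R by [].
have -> : (2 + delta) * (ln n%:R / ln 2) + (2 + delta) * (ln 3 / ln 2)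
    = (2 + delta) * (ln (3 * n)%:R / ln 2) :> R.
  by rewrite natrM lnM ?posrE ?ltr0n //; ring.
set y := ln (3 * n)%:R / ln 2.
have y0 : 0 <= y := divr_ge0 (ln_ge0 n31) (ltW ln2).
have -> : ln A / (r%:R * - ln x) = (- ln w / - ln x) * (y / r%:R).
  have lxN : ln x != 0 by rewrite -oppr_eq0 lt0r_neq0.
  by rewrite lA /a /y; field; rewrite lxN !lt0r_neq0.
have ratio : - ln w / - ln x <= D by rewrite ler_pdivrMr.
rewrite mulrCA -[leRHS](_ : (D * r%:R + delta / 2 * r%:R) * (y / r%:R) = _); last first.
  by rewrite /D; field; rewrite lt0r_neq0.
rewrite mulrA; apply: (ler_wpM2r (divr_ge0 y0 (ler0n R r))).
apply: (@le_trans _ _ (D * K%:R)).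
  exact: ler_wpM2r.
have -> : K = (q.+1 + r)%N by rewrite /K addnA addn1.
by rewrite natrD mulrDr addrC lerD2l.
Qed.

End SumUnpolarized.

(** * The SSC decoding tree *)

Section Latency.
Variable R : realType.

Section Tree.
Variables (n : nat) (A : {set 'I_(2 ^ n)}).

Definition mixed (v : seq bool) : bool := ~~ rate0 A v && ~~ rate1 A v.

Lemma mixed_cat u w : mixed (u ++ w) -> mixed u.
Proof.
have up i : leaf_below (u ++ w) i -> @leaf_below n u i.
  by apply: prefix_trans; exact: prefix_prefix.
move=> /andP[r0 r1]; apply/andP; split.
  apply: contra r0 => /forallP h; apply/forallP => i; apply/implyP => /up.
  by apply/implyP.
apply: contra r1 => /forallP h; apply/forallP => i; apply/implyP => /up.
by apply/implyP.
Qed.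

Lemma mixed_leaves v : mixed v ->
  (exists2 i, leaf_below v i & i \in A) /\ (exists2 i, leaf_below v i & i \notin A).
Proof.
rewrite /mixed /rate0 /rate1 !negb_forall => /andP[/existsP[i hi] /existsP[j hj]].
have /andP[vi iA] : leaf_below v i && ~~ (i \notin A) by rewrite -negb_imply.
have /andP[vj jA] : leaf_below v j && (j \notin A) by rewrite -negb_imply.
rewrite negbK in iA.
by split; [exists i|exists j].
Qed.

Lemma size_bits i : size (bits n i) = n.
Proof. by rewrite size_map size_iota. Qed.

(** A node below the root survives only if its parent [take d v] is mixed, and every parent has two
    children. *)
Lemma sum_ssc_tree_le d :
  \sum_(v : d.+1.-tuple bool | in_ssc_tree A v) (1 : R) <=
    2 ^+ d.+1 * bavg d (fun v => (mixed v)%:R).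
Proof.
apply: (@le_trans _ _ (\sum_(v : d.+1.-tuple bool) (mixed (take d v))%:R)).
  rewrite big_mkcond /=; apply: ler_sum => v _; case: ifP => // /forallP hv.
  have dv : (d < size v)%N by rewrite size_tuple.
  by have := hv (Ordinal dv); rewrite /= -/(mixed (take d v)) => ->.
rewrite (sum_tuple_bool d.+1 (fun v => (mixed (take d v))%:R)).
rewrite ler_wpM2l ?exprn_ge0 // bavg_rcons; apply: le_bavg => v dv.
rewrite -!cats1 !take_size_cat //; set x : R := (mixed v)%:R; lra.
Qed.

Lemma ceil_natf_le s P :
  (Num.ceil ((2 ^ s)%:R / P%:R : rat))%:~R <= 2 ^+ s / P%:R + 1 :> R.
Proof.
set x : rat := _ / _.
have : ratr (Num.ceil x)%:~R <= ratr (x + 1) :> R.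
  rewrite ler_rat; have := ceil_itv x; rewrite -lerBlDr => /andP[/ltW + _].
  by rewrite intrB.
rewrite ratr_int rmorphD rmorph1 [X in _ <= X + _]rmorphM fmorphV /= !ratr_nat.
by rewrite -[2 ^+ s]natrX.
Qed.

(** Edges into level [s] have upper endpoints at depth [d = n - s - 1]. Each weighs at most
    [2 ^ s / P + 1], and [2 ^ s * 2 ^ d.+1 = 2 ^ n]. *)
Lemma ssc_latency_le P : (0 < P)%N ->
  (ssc_latency A P)%:~R <=
    2 * \sum_(d < n) 2 ^+ d * bavg d (fun v => (mixed v)%:R)
    + (2 ^ n)%:R / P%:R * \sum_(d < n) bavg d (fun v => (mixed v)%:R) :> R.
Proof.
move=> P0; rewrite /ssc_latency rmorph_sum /= !mulr_sumr -big_split /=.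
rewrite [leRHS](reindex_inj rev_ord_inj) /=; apply: ler_sum => s _.
rewrite rmorph_sum /=.
set d := (n - s.+1)%N.
have sn := ltn_ord s.
have ds : (n - s)%N = d.+1 by rewrite /d; lia.
rewrite ds sumr_const -[X in X <= _]mulr_natr -sum1_card natr_sum.
set p := bavg d _.
have p0 : 0 <= p by apply: bavg_ge0 => v; exact: ler0n.
apply: (@le_trans _ _ ((2 ^+ s / P%:R + 1) * (2 ^+ d.+1 * p))).
  apply: ler_pM; last exact: sum_ssc_tree_le; last exact: ceil_natf_le.
    by rewrite ler0z ceil_ge0 // (lt_le_trans (ltrN10 _)) // divr_ge0 ?ler0n.
  by apply: sumr_ge0.
have -> : (2 ^ n)%:R = 2 ^+ s * 2 ^+ d.+1 :> R.
  by rewrite natrX -exprD; congr (_ ^+ _); rewrite /d; lia.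
rewrite le_eqVlt; apply/orP; left; apply/eqP.
by rewrite exprS; field; rewrite pnatr_eq0 -lt0n.
Qed.

End Tree.

(** * Bhattacharyya parameters at mixed nodes *)

Section Leaves.
Variables (W : channel R) (pe : R).
Hypotheses (hW : is_channel W) (pe01 : 0 < pe < 1).

Definition zproc (v : seq bool) : R := zpar (foldl (@polar R) W v).

Lemma is_channel_foldl v : is_channel (foldl (@polar R) W v).
Proof.
elim/last_ind: v => //= v b IH; rewrite foldl_rcons; exact: is_channel_polar.
Qed.

Lemma zproc_polar : polar_process zproc.
Proof.
split=> v; first exact: zpar_itv (is_channel_foldl v).
  by rewrite /zproc foldl_rcons zpar_polar1 //; exact: is_channel_foldl.
rewrite /zproc foldl_rcons /polar_itv /=.
by rewrite zpar_polar0_ge ?zpar_polar0_le //; exact: is_channel_foldl.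
Qed.

Lemma zproc_cat_le v w : zproc (v ++ w) <= 2 ^+ size w * zproc v.
Proof.
have [z01 zt zf] := zproc_polar.
elim/last_ind: w => [|w b IH]; first by rewrite cats0 mul1r.
rewrite -rcons_cat size_rcons exprS -mulrA.
have /andP[z0 z1] := z01 (v ++ w).
apply: (@le_trans _ _ (2 * zproc (v ++ w))); last by rewrite ler_pM2l.
case: b; first by rewrite zt; nra.
by have [] := polar_itv_bounds (z01 (v ++ w)) (zf (v ++ w)).
Qed.

(** Neither bit brings the parameter below its square. *)
Lemma zproc_cat_ge v w : zproc v ^+ (2 ^ size w) <= zproc (v ++ w).
Proof.
have [z01 zt zf] := zproc_polar.
elim/last_ind: w => [|w b IH]; first by rewrite cats0 expr1.
rewrite -rcons_cat size_rcons expnSr exprM.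
have /andP[z0 z1] := z01 (v ++ w); have /andP[v0 v1] := z01 v.
apply: (@le_trans _ _ (zproc (v ++ w) ^+ 2)).
  by rewrite ler_pXn2r ?nnegrE ?exprn_ge0.
case: b; first by rewrite zt.
have [/andP[y0 y1] _ hy] := polar_itv_bounds (z01 (v ++ w)) (zf (v ++ w)).
rewrite -(@ler_pXn2r _ 2) ?nnegrE ?exprn_ge0 //.
have : zproc (v ++ w) ^+ 2 <= 1 by nra.
by have := sqr_ge0 (zproc (v ++ w)); nra.
Qed.

Lemma bernoulli_ineq (x : R) m : 0 <= x -> 1 - m%:R * (1 - x) <= x ^+ m.
Proof.
move=> x0; elim: m => [|m IH]; first by rewrite mul0r subr0 expr0.
rewrite exprSr; apply: le_trans (ler_wpM2r x0 IH); rewrite -natr1.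
by have := mulr_ge0 (ler0n R m) (sqr_ge0 (1 - x)); nra.
Qed.

(** With [N = 2 ^ n], a frozen leaf has parameter at least [pe / N], and at most [n] doublings lead
    to it, so [zproc v >= pe / N ^ 2]. An information leaf has parameter below [pe / N <= 1/2];
    since at worst each step squares, Bernoulli's inequality gives [1 - zproc v >= 1 / (2 * N)]. *)
Lemma mixed_zproc n v : (0 < n)%N -> 1 <= pe * 2 ^+ n -> (size v < n)%N ->
  mixed (polar_info pe W n) v ->
  2^-1 ^+ (3 * n) <= zproc v /\ 2^-1 ^+ (3 * n) <= 1 - zproc v ^+ 2.
Proof.
move=> n0 hpe vn /mixed_leaves[[i vi iA] [j vj jA]].
have /andP[pe0 pe1] := pe01.
have [z01 _ _] := zproc_polar; have /andP[z0 z1] := z01 v.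
have leafE (k : 'I_(2 ^ n)) : bhattacharyya (bit_channel W k) = (zproc (bits n k))%:E.
  exact/bhattacharyyaE/is_channel_foldl.
move: iA jA; rewrite !inE !leafE !lte_fin -leNgt natrX => iA jA.
have N0 : 0 < 2 ^+ n :> R by rewrite exprn_gt0.
have size_tail k w : bits n k = v ++ w -> (size w <= n)%N.
  by move=> e; have := size_bits n k; rewrite e size_cat => <-; rewrite leq_addl.
have n2 : 2 <= 2 ^+ n :> R.
  by rewrite -[leLHS]expr1 ler_weXn2l // ler1n.
split.
  move: vj => /prefixP[w ew]; have wn := size_tail _ _ ew.
  have := zproc_cat_le v w; rewrite -ew => /(le_trans jA) h.
  have h2 : pe / 2 ^+ n <= 2 ^+ n * zproc v.
    by apply: (le_trans h); rewrite ler_wpM2r // ler_weXn2l // ler1n.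
  rewrite exprVn mulnC exprM -div1r ler_pdivrMr ?exprn_gt0 //.
  rewrite ler_pdivrMr // in h2.
  rewrite (_ : (2 ^+ n) ^+ 3 = 2 ^+ n * 2 ^+ n * 2 ^+ n); last by ring.
  apply: (le_trans hpe); nra.
move: vi => /prefixP[w ew]; have wn := size_tail _ _ ew.
have := zproc_cat_ge v w; rewrite -ew => /le_lt_trans/(_ iA).
move=> /(le_lt_trans (bernoulli_ineq (2 ^ size w) z0)) h.
have h2 : pe / 2 ^+ n <= 2^-1.
  rewrite ler_pdivrMr //; nra.
have h3 : 2^-1 <= 2 ^+ n * (1 - zproc v).
  apply: (@le_trans _ _ ((2 ^ size w)%:R * (1 - zproc v))); first lra.
  by rewrite ler_wpM2r ?subr_ge0 // natrX ler_weXn2l // ler1n.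
have h4 : 1 - zproc v <= 1 - zproc v ^+ 2 by nra.
apply: le_trans h4.
rewrite exprVn mulnC exprM -div1r ler_pdivrMr ?exprn_gt0 //.
have -> : (1 - zproc v) * (2 ^+ n) ^+ 3 = 2 ^+ n * (1 - zproc v) * (2 ^+ n) ^+ 2 by ring.
have : 4 <= (2 ^+ n) ^+ 2 :> R by nra.
nra.
Qed.

(** Markov's inequality: [64 ^ (alpha * n) * psi] is at least 1 at mixed nodes. Each depth is then
    bounded by its worst case [Lam ^ n]. *)
Lemma sum_mixed_le alpha C0 Lam n : (0 < n)%N -> 1 <= pe * 2 ^+ n ->
  0 < alpha -> 1 <= Lam -> 0 <= C0 ->
  (forall d, bavg d (fun v => psi alpha (zproc v)) <= C0 * (Lam / 2) ^+ d) ->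
  \sum_(d < n) 2 ^+ d * bavg d (fun v => (mixed (polar_info pe W n) v)%:R)
    <= n%:R * (C0 * (64 `^ alpha * Lam) ^+ n).
Proof.
move=> n0 hpe a0 L1 C00 hpsi; have L0 : 0 <= Lam by apply: le_trans L1.
have z01 v : 0 <= zproc v <= 1 by have [] := zproc_polar.
apply: (@le_trans _ _ (\sum_(d < n) (C0 * (64 `^ alpha * Lam) ^+ n))); last first.
  by rewrite sumr_const card_ord mulr_natl.
apply: ler_sum => d _.
have s0 : 0 <= (64 `^ alpha) ^+ n :> R by rewrite exprn_ge0 ?powR_ge0.
apply: (@le_trans _ _ (2 ^+ d * ((64 `^ alpha) ^+ n * (C0 * (Lam / 2) ^+ d)))).
  rewrite ler_wpM2l ?exprn_ge0 //.
  apply: le_trans (ler_wpM2l s0 (hpsi d)); rewrite -bavgZ.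
  apply: le_bavg => v dv; case: (boolP (mixed _ v)) => [vm|_]; last first.
    by rewrite mulr_ge0 // powR_ge0.
  have vn : (size v < n)%N by rewrite dv.
  have [h1 h2] := mixed_zproc n0 hpe vn vm.
  rewrite /psi -powR_mulrn ?powR_ge0 // powRAC -powRM ?powR_ge0 //; last first.
    by have /psi_base/andP[] := z01 v.
  rewrite powR_mulrn // -[leLHS](_ : 1 `^ alpha = 1); last by rewrite powR1.
  have zy : 1 <= 64 ^+ n * (zproc v * (1 - zproc v ^+ 2)).
    rewrite [leLHS](_ : 1 = 64 ^+ n * (2^-1 ^+ (3 * n) * 2^-1 ^+ (3 * n))); last first.
      rewrite -exprD -mulnDl exprM -exprMn (_ : 64 * _ = 1) ?expr1n //.
      by field.
    by rewrite ler_wpM2l ?exprn_ge0 // ler_pM ?exprn_ge0 // invr_ge0.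
  apply: ge0_ler_powR; rewrite ?nnegrE // ?(ltW a0) //.
  exact: le_trans zy.
have -> : 2 ^+ d * ((64 `^ alpha) ^+ n * (C0 * (Lam / 2) ^+ d))
    = C0 * ((64 `^ alpha) ^+ n * Lam ^+ d).
  by rewrite expr_div_n; field; rewrite expf_neq0.
by rewrite exprMn ler_wpM2l // ler_wpM2l // ler_weXn2l // ltnW.
Qed.

End Leaves.

End Latency.

(** * The latency bound *)

Section Eventually.
Variable R : realType.

(** Write [x = y ^ 2]: one factor keeps [n * y ^ n] below a geometric series, the other tends to
    0. *)
Lemma near_mul_geom (C x : R) : 0 <= x -> x < 1 ->
  \forall n \near \oo, C * (n%:R * x ^+ n) <= 1.
Proof.
move=> x0 x1; pose y := Num.sqrt x.
have y0 : 0 <= y by exact: sqrtr_ge0.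
have yx : y ^+ 2 = x by rewrite sqr_sqrtr.
have y1 : y < 1 by nra.
have y1' : 0 < 1 - y by rewrite subr_gt0.
have hn n : n%:R * y ^+ n <= (1 - y)^-1.
  apply: le_trans (sum_geom_le n y0 y1).
  apply: (@le_trans _ _ (\sum_(i < n) y ^+ n)).
    by rewrite sumr_const card_ord mulr_natl.
  by apply: ler_sum => i _; rewrite ler_wiXn2l ?(ltW y1) // ltnW.
pose D := `|C| / (1 - y) + 1.
have D0 : 0 < D by rewrite ltr_wpDl // divr_ge0 // ltW.
have DV : 0 < D^-1 by rewrite invr_gt0.
have : `|y| < 1 by rewrite ger0_norm.
move=> /cvg_expr/cvgrPdist_lt/(_ _ DV); apply: filterS => n.
rewrite /= sub0r normrN ger0_norm ?exprn_ge0 // => yn.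
have yn0 := exprn_ge0 n y0.
have -> : C * (n%:R * x ^+ n) = C * (n%:R * y ^+ n) * y ^+ n.
  by rewrite -yx exprAC expr2; ring.
apply: (@le_trans _ _ (D * y ^+ n)); last first.
  by rewrite -ler_pdivlMl // mulr1 ltW.
rewrite ler_wpM2r //.
apply: (@le_trans _ _ (`|C| * (1 - y)^-1)); last by rewrite lerDl.
apply: (@le_trans _ _ (`|C| * (n%:R * y ^+ n))).
  by rewrite ler_wpM2r ?ler_norm // mulr_ge0 ?ler0n.
by rewrite ler_wpM2l.
Qed.

Lemma near_log2_ge (C : R) : \forall n \near \oo, C <= log2 n%:R.
Proof.
have l2 : 0 < ln (2 : R) by rewrite ln_gt0 // ltr1n.
near=> n; rewrite ler_pdivlMr //.
have h : expR (C * ln 2) <= n%:R.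
  by near: n; exact: nbhs_infty_ger.
by rewrite -[leLHS]expRK ler_ln ?posrE ?expR_gt0 // (lt_le_trans (expR_gt0 _) h).
Unshelve. all: end_near. Qed.

End Eventually.

(** * Logarithms to base 2 *)

Lemma log2D (R : realType) (x y : R) : 0 < x -> 0 < y ->
  log2 (x * y) = log2 x + log2 y.
Proof. by move=> x0 y0; rewrite /log2 lnM ?posrE // mulrDl. Qed.

Lemma ler_log2 (R : realType) (x y : R) : 0 < x -> x <= y -> log2 x <= log2 y.
Proof.
move=> x0 xy; rewrite ler_pM2r ?invr_gt0 ?ln_gt0 ?ltr1n //.
by rewrite ler_ln ?posrE // (lt_le_trans x0).
Qed.

Lemma log2_exprn (R : realType) (x : R) n : 0 < x -> log2 (x ^+ n) = n%:R * log2 x.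
Proof. by move=> x0; rewrite /log2 lnXn // -[_ *+ n]mulr_natl mulrA. Qed.

Lemma log2_2 (R : realType) : log2 2 = 1 :> R.
Proof. by rewrite /log2 divff // lt0r_neq0 // ln_gt0 // ltr1n. Qed.

Lemma log2_1 (R : realType) : log2 1 = 0 :> R.
Proof. by rewrite /log2 ln1 mul0r. Qed.

Unset Implicit Arguments.
Set Strict Implicit.

Theorem theorem1 (R : realType) (mu : R) (hmu : 0 < mu)
    (hub : scaling_exponent_upper_bound mu) :
  exists c : R, 0 < c /\
    forall (W : channel R) (pe : R),
      is_BMS W ->
      0 < pe < 1 ->
      ((polar_rate pe W n)%:E @[n --> \oo] --> symmetric_capacity W) ->
      forall eps : R, 0 < eps ->
      exists Nbar : nat, forall n P : nat,
        (Nbar <= 2 ^ n)%N -> (1 <= P)%N -> (2 * P <= 2 ^ n)%N ->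
        let N : R := (2 ^ n)%:R in
        (ssc_latency (polar_info pe W n) P)%:~R <=
          c * N `^ (1 - mu^-1)
          + (2 + eps) * (N / P%:R) * log2 (log2 (N / P%:R)).
Proof.
have [alpha [Lam [kappa [K [G [[a0 L1 aLB k0] [HG Hstep]]]]]]] := exists_potential hub.
(* One copy of [N ^ (1 - 1 / mu)] pays for the rounding sum, the other for the second sum when
   [N / P] is small. *)
exists 2; split=> // W pe /is_BMS_channel hW pe01 _ eps eps0.
have L0 : 0 < Lam by apply: lt_le_trans L1.
set B := 2 `^ _ in aLB.
set x := _ * Lam in aLB.
have u1 : 1 <= (64 : R) `^ alpha.
  by rewrite -[leLHS](powRr0 64) ler_powR ?ler1n // ltW.
have Lx : Lam <= x by rewrite /x; nra.
have x0 : 0 < x by apply: lt_le_trans Lx.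
have B0 : 0 < B by apply: lt_trans aLB.
have B1 : 1 < B by apply: le_lt_trans aLB; apply: le_trans Lx.
have B2 : B < 2.
  have l2 : 0 < ln (2 : R) by rewrite ln_gt0 // ltr1n.
  rewrite /B /powR pnatr_eq0 /= -[ltRHS]lnK ?posrE // ltr_expR gtr_pMl //.
  by rewrite ltrBlDr ltrDl invr_gt0.
have zp := zproc_polar hW.
have hpsi d := polar_process_psi d zp a0 L1 k0 HG Hstep.
have C00 : 0 <= K / kappa.
  have := hpsi 0%N; rewrite expr0 mulr1 /=; apply: le_trans; exact: powR_ge0.
have lam0 : 0 <= Lam / 2 by rewrite divr_ge0 // ltW.
have lam1 : Lam / 2 < 1 by rewrite ltr_pdivrMr // mul1r; lra.
(* Only [eps / 2] is spent here; the other half absorbs [C] and [log2 (beta / 2)] for large [n]. *)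
have [C hC] := sum_bavg_le zp a0 lam0 lam1 hpsi (divr_gt0 eps0 (ltr0n R 2)).
have /andP[pe0 pe1] := pe01.
pose beta := log2 B.
have beta0 : 0 < beta by rewrite divr_gt0 ?ln_gt0 ?ltr1n.
have beta20 : 0 < beta / 2 by rewrite divr_gt0.
have [n0 hn0] : exists n0, forall n, (n0 <= n)%N ->
    [/\ (0 < n)%N, 1 <= pe * 2 ^+ n,
        2 * (n%:R * (K / kappa * x ^+ n)) <= B ^+ n,
        (2 + eps / 2) * log2 n%:R + C <= (2 + eps) * (log2 n%:R + log2 (beta / 2)) &
        n%:R ^+ 2 <= B ^+ n].
  suff [n0 _ hn0] : \forall n \near \oo,
    [/\ (0 < n)%N, 1 <= pe * 2 ^+ n,
        2 * (n%:R * (K / kappa * x ^+ n)) <= B ^+ n,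
        (2 + eps / 2) * log2 n%:R + C <= (2 + eps) * (log2 n%:R + log2 (beta / 2)) &
        n%:R ^+ 2 <= B ^+ n].
    by exists n0 => n n0n; exact: hn0.
  have xB0 : 0 <= x / B by rewrite divr_ge0 // ltW.
  have xB1 : x / B < 1 by rewrite ltr_pdivrMr // mul1r.
  pose r := Num.sqrt B.
  have rB : r ^+ 2 = B by rewrite sqr_sqrtr // ltW.
  have r0 : 0 < r by rewrite sqrtr_gt0.
  have r1 : r^-1 < 1 by rewrite invf_lt1 //; nra.
  near=> n.
  have Bn : 0 < B ^+ n by rewrite exprn_gt0.
  split.
  - by near: n; exists 1%N.
  - have : pe^-1 * (n%:R * 2^-1 ^+ n) <= 1.
      by near: n; apply: near_mul_geom; lra.
    have n1 : 1 <= n%:R :> R by rewrite ler1n; near: n; exists 1%N.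
    rewrite mulrA exprVn ler_pdivrMr ?exprn_gt0 // mul1r ler_pdivrMl //.
    exact: le_trans.
  - have : 2 * (K / kappa) * (n%:R * (x / B) ^+ n) <= 1.
      by near: n; exact: near_mul_geom.
    rewrite expr_div_n !mulrA ler_pdivrMr // mul1r; apply: le_trans.
    by rewrite le_eqVlt; apply/orP; left; apply/eqP; ring.
  - have : (C - (2 + eps) * log2 (beta / 2)) / (eps / 2) <= log2 n%:R.
      by near: n; exact: near_log2_ge.
    by rewrite ler_pdivrMr ?divr_gt0 //; nra.
  - have : 1 * (n%:R * r^-1 ^+ n) <= 1.
      by near: n; apply: near_mul_geom => //; rewrite invr_ge0 ltW.
    rewrite mul1r exprVn ler_pdivrMr ?exprn_gt0 // mul1r => h.
    by rewrite -rB -exprM mulnC exprM ler_pXn2r ?nnegrE ?exprn_ge0 ?(ltW r0).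
exists (2 ^ n0)%N => n P hN P0 P2; lazy zeta; set N : R := (2 ^ n)%:R.
have /hn0[n_gt0 hpe hS1 hS2 hn] : (n0 <= n)%N by rewrite -(@leq_exp2l 2).
have e20 : 0 < 2 + eps by rewrite ltr_wpDl.
have NE : N = 2 ^+ n by rewrite /N natrX.
have NB : N `^ (1 - mu^-1) = B ^+ n.
  by rewrite NE -powR_mulrn // powRAC powR_mulrn // powR_ge0.
have PR0 : 0 < P%:R :> R by rewrite ltr0n.
set M := N / P%:R.
have M2 : 2 <= M by rewrite ler_pdivlMr // -natrM ler_nat.
have M0 : 0 < M by apply: lt_le_trans M2.
have lat := ssc_latency_le R (polar_info pe W n) P0.
rewrite -/N -/M in lat; apply: (le_trans lat).
have S1 := sum_mixed_le hW pe01 n_gt0 hpe a0 L1 C00 hpsi.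
set S2 := \sum_(d < n) bavg d _ in lat *.
have {}S1 : 2 * \sum_(d < n) 2 ^+ d * bavg d (fun v => (mixed (polar_info pe W n) v)%:R)
    <= B ^+ n.
  by apply: le_trans hS1; rewrite ler_pM2l.
have -> : 2 * N `^ (1 - mu^-1) = B ^+ n + B ^+ n by rewrite NB; ring.
rewrite -[leRHS]addrA; apply: lerD S1 _.
have log2M : 1 <= log2 M by rewrite -(log2_2 R) ler_log2.
have loglogM : 0 <= log2 (log2 M) by rewrite -(log2_1 R) ler_log2.
have S2n : S2 <= n%:R.
  rewrite -[leRHS](_ : \sum_(d < n) (1 : R) = n%:R); last first.
    by rewrite sumr_const card_ord.
  apply: ler_sum => d _; rewrite -[leRHS](bavg_cst d).
  by apply: le_bavg => v _; case: (mixed _ v).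
have [small|large] := leP (M * n%:R) (B ^+ n).
  apply: (@le_trans _ _ (B ^+ n)).
    by apply: le_trans small; rewrite ler_pM2l.
  by rewrite lerDl; apply: mulr_ge0 => //; apply: mulr_ge0; exact: ltW.
apply: (@le_trans _ _ ((2 + eps) * M * log2 (log2 M))); last first.
  by rewrite lerDr exprn_ge0 // ltW.
rewrite -mulrA mulrCA ler_pM2l //.
have S2C : S2 <= (2 + eps / 2) * log2 n%:R + C.
  apply: hC => //; first exact: mixed_cat.
  by move=> v vn vm; exact: mixed_zproc hpe vn vm.
apply: (le_trans S2C); apply: (le_trans hS2).
rewrite ler_pM2l //.
have nR0 : 0 < n%:R :> R by rewrite ltr0n.
rewrite -log2D //; apply: ler_log2; first exact: mulr_gt0.
(* [B ^ (2 * n) <= M ^ 2 * n ^ 2 <= M ^ 2 * B ^ n]; taking logarithms, [log2 M >= n * beta / 2]. *)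
have hM : B ^+ n <= M ^+ 2.
  have BM : B ^+ n * B ^+ n <= (M * n%:R) * (M * n%:R).
    by rewrite ler_pM ?exprn_ge0 ?(ltW B0) // ltW.
  have Bn : 0 < B ^+ n by rewrite exprn_gt0.
  rewrite -(ler_pM2r Bn); apply: (le_trans BM).
  rewrite (_ : M * n%:R * (M * n%:R) = M ^+ 2 * n%:R ^+ 2); last by ring.
  by rewrite ler_wpM2l // exprn_ge0 // ltW.
have := ler_log2 (exprn_gt0 n B0) hM.
rewrite !log2_exprn // -/beta => h.
rewrite mulrA; lra.
Unshelve. all: end_near. Qed.
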